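(* In the multi-period market described in the context, let $D$ be the time inconsistent equilibrium price. Then the time inconsistent pricing kernel equals the marginal utility, i.e., for every $n=1,\dots,N$, $$\hat\Lambda_{t_{N-n+1}}=\frac{\mathbb E_{t_{N-n+1}}[U'(\hat W_{t_N})]}{\mathbb E_{t_{N-n}}[U'(\hat W_{t_N})]},$$ where $U(x)=-e^{-\gamma x}$ with $\gamma=\gamma_{t_0}$, and $\hat W_{t_N}=W^{\hat\pi}_{t_N}$ is the optimal time inconsistent final wealth.
   Context: Time grid: $t_n=nh$, $n=0,\dots,N$, $h=T/N$, $T>0$ fixed. For a process $Z$, $\Delta Z_{t_n}=Z_{t_{n+1}}-Z_{t_n}$. Noise: $(b^1,\dots,b^d)$ is a $d$-dimensional symmetric binomial random walk on a complete filtered probability space $(\Omega,\mathcal F,\{\mathcal F_{t_n}\},\mathbb P)$, adapted to the filtration, with $\mathbb P(\Delta b^i_{t_n}=\pm1)=1/2$ for each $i$ and with increments $\Delta b_{t_n}$ independent of $\mathcal F_{t_n}$. Assets: the riskless bond is the numeraire (zero interest rate). The primary traded asset satisfies $\Delta C_{t_n}=C_{t_n}(\mu^c_{t_n}h+\sigma^c_{t_n}\sqrt h\,\Delta b^1_{t_n})$, $C_0=c>0$, and the non-traded asset satisfies $\Delta S_{t_n}=S_{t_n}(\mu^s_{t_n}h+\sigma^s_{t_n}\sqrt h(\rho\Delta b^1_{t_n}+\sqrt{1-\rho^2}\,\Delta b^2_{t_n}))$, $S_0=s>0$, $|\rho|<1$, where the drifts and volatilities are adapted processes, chosen so that $C$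 stays positive. A derivative security $D$, written on $C$ and $S$ and with adapted price process, has a given $\mathcal F_{t_N}$-measurable terminal payoff $D_{t_N}$ and pays dividend $\varphi(t_n,C_{t_n},S_{t_n})h$ for holding it on $[t_n,t_{n+1}]$. The market price of risk is $r^c_{t_n}=\mu^c_{t_n}/\sigma^c_{t_n}$, assumed positive, and $h$ is small enough that $r^c_{t_n}\sqrt h<1$. Agent: a strategy is $\pi_{t_n}=(\alpha_{t_n},\beta_{t_n})$, $\mathcal F_{t_n}$-measurable ($\alpha$ = wealth in the primary asset, $\beta$ = number of shares of derivative). Self-financing wealth satisfies $$\Delta X^\pi_{t_n}=\alpha_{t_n}(\mu^c_{t_n}h+\sigma^c_{t_n}\sqrt h\,\Delta b^1_{t_n})+\beta_{t_n}(\Delta D_{t_n}+\varphi(t_n,C_{t_n},S_{t_n})h).$$ At $t_N=T$ the agent receives an $\mathcal F_T$-measurable random income $I_{t_N}$; final wealth is $W^\pi_{t_N}=X^\pi_{t_N}+I_{t_N}$. The risk aversion $\gamma_{t_n}>0$ is an adapted process. $\Pi_{t_0}$ is the set of strategies $(\pi_{t_0},\dots,\pi_{t_{N-1}})$ with $\pi_{t_k}$ $\mathcal F_{t_k}$-measurable and $\mathbb E|X^\pi_{t_k}|<\infty$, $k=0,\dots,N-1$. All expectations written are assumed finite. Optimal time inconsistent strategy: $\hat\pi=(\hat\alpha,\hat\beta)\in\Pi_{t_0}$ attaining $\sup_{\pi\in\Pi_{t_0}}\mathbb E[-\exp(-\gamma_{t_0}W^\pi_{t_N})|\mathcal F_{t_0}]$.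 Given $D_{t_N}$ and the dividend stream, $D_{t_n}$ is a time inconsistent equilibrium price if and only if $\hat\beta_{t_n}=1$ for every $n=0,\dots,N-1$. Notation: $A_{t_k}=\{\Delta b^1_{t_k}=1\}$, $A^c_{t_k}=\{\Delta b^1_{t_k}=-1\}$; $\mathbb E_{t_k}[\cdot]=\mathbb E[\cdot|\mathcal F_{t_k}]$ (similarly under other measures); $\mathbb E_{t_k}[Z|A]$ denotes the conditional expectation given $\mathcal F_{t_k}$ and the occurrence of the event $A$, i.e. $\mathbb E[Z1_A|\mathcal F_{t_k}]/\mathbb P(A|\mathcal F_{t_k})$. Time inconsistent pricing kernel (defined backwards, for $k=N-1,\dots,0$; empty sums are $0$): $$e^{-\gamma_{t_0}\hat Y_{t_{k+1}}}=\mathbb E_{t_{k+1}}\Big[e^{-\gamma_{t_0}[\sum_{j=k+1}^{N-1}\Delta\hat X_{t_j}+I_{t_N}]}\Big],$$ $$\Delta\hat X_{t_j}=\hat\alpha_{t_j}(\mu^c_{t_j}h+\sqrt h\sigma^c_{t_j}\Delta b^1_{t_j})+\Delta D_{t_j}+\varphi(t_j,C_{t_j},S_{t_j})h,$$ where $\hat\alpha$, the optimal time inconsistent strategy in the primary asset, is given by $$\hat\alpha_{t_k}=\frac{1}{2\gamma_{t_0}\sigma^c_{t_k}\sqrt h}\log\left(\frac{1+r^c_{t_k}\sqrt h}{1-r^c_{t_k}\sqrt h}\right)+\frac{1}{2\gamma_{t_0}\sigma^c_{t_k}\sqrt h}\log\left(\frac{\mathbb E_{t_k}[e^{-\gamma_{t_0}[D_{t_{k+1}}+\hat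 Y_{t_{k+1}}]}|A_{t_k}]}{\mathbb E_{t_k}[e^{-\gamma_{t_0}[D_{t_{k+1}}+\hat Y_{t_{k+1}}]}|A^c_{t_k}]}\right),$$ and $$\hat\Lambda_{t_{k+1}}=\lambda_{t_k}\frac{e^{-\gamma_{t_0}[D_{t_{k+1}}+\hat Y_{t_{k+1}}]}}{\mathbb E_{t_k}[e^{-\gamma_{t_0}[D_{t_{k+1}}+\hat Y_{t_{k+1}}]}|A_{t_k}]}\ \text{on }A_{t_k},\qquad \hat\Lambda_{t_{k+1}}=\lambda_{t_k}\frac{e^{-\gamma_{t_0}[D_{t_{k+1}}+\hat Y_{t_{k+1}}]}}{\mathbb E_{t_k}[e^{-\gamma_{t_0}[D_{t_{k+1}}+\hat Y_{t_{k+1}}]}|A^c_{t_k}]}\ \text{on }A^c_{t_k},$$ with $\lambda_{t_k}=1-r^c_{t_k}\sqrt h$ on $A_{t_k}$ and $\lambda_{t_k}=1+r^c_{t_k}\sqrt h$ on $A^c_{t_k}$. The time inconsistent equilibrium price satisfies $D_{t_k}=\mathbb E_{t_k}^{\hat Q}[D_{t_{k+1}}+\varphi(t_k,C_{t_k},S_{t_k})h]$ with $d\hat Q/d\mathbb P=\hat\Lambda_{t_N}\cdots\hat\Lambda_{t_1}$. *)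

(* Defs.v *)
From mathcomp Require Import all_boot all_order all_algebra.
From mathcomp Require Import all_classical all_reals all_analysis.

Set Implicit Arguments.
Unset Strict Implicit.
Unset Printing Implicit Defensive.

Import Order.TTheory GRing.Theory Num.Theory.
Import numFieldNormedType.Exports.

Local Open Scope classical_set_scope.
Local Open Scope ring_scope.

Section conditional_expectation.
Context {R : realType} {disp : measure_display} {Omega : measurableType disp}.
Variable P : probability Omega R.
Implicit Types (G H : set (set Omega)) (X Y Z : Omega -> R) (A : set Omega).

Definition rv_wrt G X : Prop := forall B : set R, measurable B -> G (X @^-1` B).

Definition rv_integrable X : Prop := P.-integrable [set: Omega] (EFin \o X).

Definition is_condexp G X Y : Prop :=
  [/\ rv_integrable X, rv_integrable Y, rv_wrt G Y &
      forall A, G A -> (\int[P]_(w in A) (Y w)%:E = \int[P]_(w in A) (X w)%:E)%E].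

(* A chosen version of the conditional expectation of X given G, meaningful
   when X is integrable (and equal to 0 otherwise). Versions agree almost
   surely, and all statements about condexp below are almost sure ones. *)
Definition condexp G X : Omega -> R := xget (cst 0) [set Y | is_condexp G X Y].

(* Conditional expectation given G and the occurrence of A. *)
Definition condexp_event G X A : Omega -> R :=
  fun w => condexp G (X \* \1_A) w / condexp G (\1_A) w.

Definition independent_sets G H : Prop :=
  forall A B, G A -> H B -> P (A `&` B) = (P A * P B)%E.

End conditional_expectation.

(* Processes are indexed by the grid index k, which stands for t_k = k * h;
   only the indices k <= nsteps (k < nsteps for increments and strategies)
   are ever constrained or used. *)
Record market (R : realType) (Omega : Type) := Market {
  horizon : R;
  nsteps : nat;
  filtration : nat -> set (set Omega);
  (* The walk has dimension (walk_dim + 2): both b^1 and b^2 must exist. *)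
  walk_dim : nat;
  walk : 'I_walk_dim.+2 -> nat -> Omega -> R;
  c0 : R;
  s0 : R;
  mu_c : nat -> Omega -> R;
  sigma_c : nat -> Omega -> R;
  mu_s : nat -> Omega -> R;
  sigma_s : nat -> Omega -> R;
  rho : R;
  dividend : R -> R -> R -> R;
  price : nat -> Omega -> R;
  income : Omega -> R;
  initial_wealth : Omega -> R;
  gamma : nat -> Omega -> R
}.

Arguments walk {R Omega} m.

Record strategy (R : realType) (Omega : Type) := Strategy {
  in_asset : nat -> Omega -> R;
  in_derivative : nat -> Omega -> R
}.

Section market_dynamics.
Context {R : realType} {Omega : Type}.
Variable M : market R Omega.
Local Notation N := (nsteps M).
Local Notation F := (filtration M).

Definition step : R := horizon M / N%:R.
Local Notation h := step.

Definition grid (k : nat) : R := k%:R * h.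

Definition incr (Z : nat -> Omega -> R) (k : nat) (w : Omega) : R :=
  Z k.+1 w - Z k w.

Definition b1 : nat -> Omega -> R := walk M (ord0 : 'I_(walk_dim M).+2).
Definition b2 : nat -> Omega -> R :=
  walk M (lift ord0 ord0 : 'I_(walk_dim M).+2).

Definition return_c (k : nat) (w : Omega) : R :=
  mu_c M k w * h + sigma_c M k w * Num.sqrt h * incr b1 k w.

Definition return_s (k : nat) (w : Omega) : R :=
  mu_s M k w * h + sigma_s M k w * Num.sqrt h *
    (rho M * incr b1 k w + Num.sqrt (1 - rho M ^+ 2) * incr b2 k w).

Fixpoint asset_c (k : nat) (w : Omega) : R :=
  if k is j.+1 then asset_c j w + asset_c j w * return_c j w else c0 M.

Fixpoint asset_s (k : nat) (w : Omega) : R :=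
  if k is j.+1 then asset_s j w + asset_s j w * return_s j w else s0 M.

Definition dividend_paid (k : nat) (w : Omega) : R :=
  dividend M (grid k) (asset_c k w) (asset_s k w) * h.

Definition risk_price (k : nat) (w : Omega) : R := mu_c M k w / sigma_c M k w.

Definition wealth_incr (pi : strategy R Omega) (k : nat) (w : Omega) : R :=
  in_asset pi k w * return_c k w +
  in_derivative pi k w * (incr (price M) k w + dividend_paid k w).

Fixpoint wealth (pi : strategy R Omega) (k : nat) (w : Omega) : R :=
  if k is j.+1 then wealth pi j w + wealth_incr pi j w
  else initial_wealth M w.

Definition final_wealth (pi : strategy R Omega) (w : Omega) : R :=
  wealth pi N w + income M w.

Definition utility (g : R) : R -> R := fun x => - expR (- g * x).

Definition marginal_utility (g : R) : R -> R := derive1 (utility g).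

Definition gamma0 : Omega -> R := gamma M 0%N.

Definition final_utility (pi : strategy R Omega) (w : Omega) : R :=
  utility (gamma0 w) (final_wealth pi w).

Definition final_marginal_utility (pi : strategy R Omega) (w : Omega) : R :=
  marginal_utility (gamma0 w) (final_wealth pi w).

End market_dynamics.

Section market_model.
Context {R : realType} {disp : measure_display} {Omega : measurableType disp}.
Variables (P : probability Omega R) (M : market R Omega).
Local Notation N := (nsteps M).
Local Notation F := (filtration M).
Local Notation h := (step M).

Definition adapted_until (m : nat) (Z : nat -> Omega -> R) : Prop :=
  forall k, (k <= m)%N -> rv_wrt (F k) (Z k).

Definition adapted_before (m : nat) (Z : nat -> Omega -> R) : Prop :=
  forall k, (k < m)%N -> rv_wrt (F k) (Z k).

Record complete_filtration : Prop := {
  filtration_sigma : forall k, (k <= N)%N -> sigma_algebra [set: Omega] (F k);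
  filtration_sub : forall k, (k <= N)%N -> F k `<=` measurable;
  filtration_mono : forall j k, (j <= k <= N)%N -> F j `<=` F k;
  space_complete : measure_is_complete P;
  filtration_complete : P.-negligible `<=` F 0%N
}.

Record symmetric_binomial_walk : Prop := {
  walk_adapted : forall i, adapted_until N (walk M i);
  walk_up : forall i k, (k < N)%N ->
    P [set w | incr (walk M i) k w = 1] = (2^-1)%:E;
  walk_down : forall i k, (k < N)%N ->
    P [set w | incr (walk M i) k w = -1] = (2^-1)%:E;
  (* g_sigma_preimage is the sigma-algebra generated by the whole vector of
     increments. *)
  walk_indep : forall k, (k < N)%N ->
    independent_sets P (F k)
      (g_sigma_preimage (fun i => incr (walk M i) k))
}.

Record market_axioms : Prop := {
  horizon_gt0 : 0 < horizon M;
  nsteps_gt0 : (0 < N)%N;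
  market_filtration : complete_filtration;
  market_walk : symmetric_binomial_walk;
  c0_gt0 : 0 < c0 M;
  s0_gt0 : 0 < s0 M;
  mu_c_adapted : adapted_before N (mu_c M);
  sigma_c_adapted : adapted_before N (sigma_c M);
  mu_s_adapted : adapted_before N (mu_s M);
  sigma_s_adapted : adapted_before N (sigma_s M);
  rho_lt1 : `|rho M| < 1;
  asset_c_gt0 : forall k, (k <= N)%N -> {ae P, forall w, 0 < asset_c M k w};
  (* These two imply that sigma_c M k is almost surely nonzero, since x / 0 is
     0 here. *)
  risk_price_gt0 : forall k, (k < N)%N ->
    {ae P, forall w, 0 < risk_price M k w};
  risk_price_small : forall k, (k < N)%N ->
    {ae P, forall w, risk_price M k w * Num.sqrt h < 1};
  dividend_measurable : forall k, (k < N)%N ->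
    measurable_fun [set: R * R] (fun x => dividend M (grid M k) x.1 x.2);
  price_adapted : adapted_until N (price M);
  income_measurable : rv_wrt (F N) (income M);
  initial_wealth_measurable : rv_wrt (F 0%N) (initial_wealth M);
  gamma_adapted : adapted_until N (gamma M);
  gamma_gt0 : forall k, (k <= N)%N -> {ae P, forall w, 0 < gamma M k w}
}.

Record admissible (pi : strategy R Omega) : Prop := {
  in_asset_adapted : adapted_before N (in_asset pi);
  in_derivative_adapted : adapted_before N (in_derivative pi);
  wealth_integrable : forall k, (k < N)%N -> rv_integrable P (wealth M pi k)
}.

(* The supremum over pi of the conditional expected utilities given F 0 is an
   essential supremum, since F 0 need not be trivial; it is attained at a
   member of the family exactly when that member dominates all the others
   almost surely. Expected utilities are required to be finite. *)
Record optimal (pihat : strategy R Omega) : Prop := {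
  optimal_admissible : admissible pihat;
  optimal_integrable : rv_integrable P (final_utility M pihat);
  optimal_max : forall pi : strategy R Omega,
    admissible pi -> rv_integrable P (final_utility M pi) ->
    {ae P, forall w, condexp P (F 0%N) (final_utility M pi) w <=
                     condexp P (F 0%N) (final_utility M pihat) w}
}.

(* The price process of M is a time inconsistent equilibrium price, pihat
   being the optimal time inconsistent strategy. *)
Definition equilibrium_price (pihat : strategy R Omega) : Prop :=
  optimal pihat /\
  forall k, (k < N)%N -> {ae P, forall w, in_derivative pihat k w = 1}.

Definition up_event (k : nat) : set Omega := [set w | incr (b1 M) k w = 1].
Definition down_event (k : nat) : set Omega := [set w | incr (b1 M) k w = -1].

Section pricing_kernel.
Variables (alphahat Yhat Lambdahat : nat -> Omega -> R).

Definition Xhat_incr (j : nat) (w : Omega) : R :=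
  alphahat j w * return_c M j w + incr (price M) j w + dividend_paid M j w.

Definition exp_tail (k : nat) (w : Omega) : R :=
  expR (- gamma0 M w * (\sum_(k <= j < N) Xhat_incr j w + income M w)).

Definition kernel_weight (k : nat) (w : Omega) : R :=
  expR (- gamma0 M w * (price M k.+1 w + Yhat k.+1 w)).

(* The defining relations of the kernel at time k + 1. By downward induction
   on k they determine Yhat, alphahat and Lambdahat up to null sets; no
   relation between alphahat and an optimal strategy is assumed here. *)
Record kernel_relations (k : nat) : Prop := {
  Yhat_eq : {ae P, forall w,
    expR (- gamma0 M w * Yhat k.+1 w) =
    condexp P (F k.+1) (exp_tail k.+1) w};
  alphahat_eq : {ae P, forall w,
    alphahat k w =
      (2 * gamma0 M w * sigma_c M k w * Num.sqrt h)^-1 *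
        ln ((1 + risk_price M k w * Num.sqrt h) /
            (1 - risk_price M k w * Num.sqrt h)) +
      (2 * gamma0 M w * sigma_c M k w * Num.sqrt h)^-1 *
        ln (condexp_event P (F k) (kernel_weight k) (up_event k) w /
            condexp_event P (F k) (kernel_weight k) (down_event k) w)};
  Lambdahat_up : {ae P, forall w, up_event k w ->
    Lambdahat k.+1 w = (1 - risk_price M k w * Num.sqrt h) *
      (kernel_weight k w /
       condexp_event P (F k) (kernel_weight k) (up_event k) w)};
  Lambdahat_down : {ae P, forall w, down_event k w ->
    Lambdahat k.+1 w = (1 + risk_price M k w * Num.sqrt h) *
      (kernel_weight k w /
       condexp_event P (F k) (kernel_weight k) (down_event k) w)}
}.

Record pricing_kernel : Prop := {
  kernel_eqs : forall k, (k < N)%N -> kernel_relations k;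
  exp_tail_integrable : forall k, (k < N)%N ->
    rv_integrable P (exp_tail k.+1);
  kernel_weight_integrable : forall k, (k < N)%N ->
    rv_integrable P (kernel_weight k)
}.

End pricing_kernel.

End market_model.

(* Main.v *)
From HB Require Import structures.
Require Import Defs.
From mathcomp Require Import all_boot all_order all_algebra.
From mathcomp Require Import all_classical all_reals all_analysis.
From mathcomp Require Import measurable_realfun ring lra.

Set Implicit Arguments.
Unset Strict Implicit.
Unset Printing Implicit Defensive.

Import Order.TTheory GRing.Theory Num.Theory.
Import numFieldNormedType.Exports.

Local Open Scope classical_set_scope.
Local Open Scope ring_scope.

(** The exponential utility turns the additive structure of final wealth into
    a product.  With g the initial risk aversion, X the wealth process of the
    optimal strategy and W its final wealth, one has up to null sets
      exp(- g W) = exp(- g X_{k+1}) * tail_{k+1},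
    where tail_{k+1} collects the gains made after time k+1 and the income.
    Conditioning at time k+1 turns the second factor into
    exp(- g Yhat_{k+1}), so that on each of the two events b^1 up, b^1 down
    of step k, the variable E_{k+1}[exp(- g W)] is the product of an
    F_k-measurable discount (which depends on the event through the return of
    the asset C) and of the weight exp(- g (D_{k+1} + Yhat_{k+1})) of the
    pricing kernel ([condexp_on_event]).

    Optimality enters through its first order condition: adding a small
    multiple of a bounded F_k-measurable amount to the holding in C at step k
    alone cannot increase the expected utility, so that
      (1 + r sqrt h) E_k[exp(- g W) 1_up]
        = (1 - r sqrt h) E_k[exp(- g W) 1_down]
    with r the market price of risk ([optimal_first_order],
    [first_order_condexp]).  The two terms of this equation are the discounts
    times the conditional expectations of the kernel weight on the events;
    solving it for the holding in C gives exactly the formula that defines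
    alphahat_k, and adding the two terms evaluates E_k[exp(- g W)], which
    identifies the ratio E_{k+1}[exp(- g W)] / E_k[exp(- g W)] with
    Lambdahat_{k+1} ([kernel_one_step], [kernel_step]).  The first of these
    conclusions extends the product formula from k+1 to k, since the derivative
    position is 1 in equilibrium; downward induction starting from the
    terminal date ([tail_factorizationP]) then makes the second one available
    at every step.  Since the marginal utility is g exp(- g W) and g is known
    at time 0, the factor g cancels in the quotient of the statement.

    The conditional expectations are obtained from the Radon-Nikodym theorem
    on the coarser sigma-algebra, which also yields the rule for pulling out
    known factors ([ge0_condexp_density], [condexpP], [is_condexpM]). *)

(** * Elementary real analysis *)

Section elementary.
Context {R : realType}.

(** This is the tangent line bound at - y, inverted. *)
Lemma expR_le_quadratic (y : R) :
  `|y| <= 2^-1 -> expR y <= 1 + y + 2 * y ^+ 2.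
Proof.
rewrite ler_norml => /andP[y1 y2]; have y3 : 0 < 1 - y by lra.
have e1 : 1 - y <= expR (- y) by exact: expR_ge1Dx.
rewrite -[y in expR y]opprK expRN.
have : (expR (- y))^-1 <= (1 - y)^-1 by rewrite lef_pV2// posrE expR_gt0.
move=> /le_trans; apply; rewrite -div1r ler_pdivrMr//; nra.
Qed.

(** A linear term dominated by a quadratic one near 0 vanishes: the witness e
    proportional to d is small enough to lie in the range of the hypothesis
    and to make the quadratic term at most half of the linear one. *)
Lemma eq0_quadratic_bound (m d : R) : 0 <= m ->
  (forall e, `|e| <= 2^-1 -> e * d <= 2 * e ^+ 2 * m) -> d = 0.
Proof.
move=> m0 H; apply/eqP; apply/negPn/negP => d0.
have dp : 0 < `|d| by rewrite normr_gt0.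
have q0 : 0 < 4 * (`|d| + m) by lra.
have := H (d / (4 * (`|d| + m))).
rewrite normrM normfV (gtr0_norm q0) ler_pdivrMr//.
have -> : `|d| <= 2^-1 * (4 * (`|d| + m)) by lra.
move=> /(_ isT).
have -> : d / (4 * (`|d| + m)) * d = `|d| ^+ 2 / (4 * (`|d| + m)).
  by rewrite real_normK ?num_real//; ring.
have -> : 2 * (d / (4 * (`|d| + m))) ^+ 2 * m =
    (`|d| ^+ 2 / (4 * (`|d| + m))) * (2 * m / (4 * (`|d| + m))).
  by rewrite real_normK ?num_real//; ring.
have c0 : 0 < `|d| ^+ 2 / (4 * (`|d| + m)) by rewrite divr_gt0// exprn_gt0.
rewrite -[X in X <= _]mulr1 ler_pM2l// ler_pdivlMr//; lra.
Qed.

(** The weight exp(- (a + b)) is a measurable normalization that makes both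
    b and a b bounded, without any division. *)
Lemma mul_expRN_le1 (a b : R) : 0 <= a -> 0 <= b ->
  b * expR (- (a + b)) <= 1 /\ a * (b * expR (- (a + b))) <= 1.
Proof.
have le1 (x : R) : 0 <= x -> x * expR (- x) <= 1.
  move=> x0; rewrite expRN ler_pdivrMr ?expR_gt0// mul1r.
  by apply: le_trans (expR_ge1Dx x); rewrite lerDr.
move=> a0 b0; rewrite opprD expRD.
have := le1 _ a0; have := le1 _ b0.
have ea : expR (- a) <= 1 by rewrite expR_le1 oppr_le0.
have := expR_gt0 (- a); have := expR_gt0 (- b).
move: ea; set x := expR (- a); set y := expR (- b) => ea y0 x0 hb ha.
have by0 : 0 <= b * y by rewrite mulr_ge0// ltW.
have ax0 : 0 <= a * x by rewrite mulr_ge0// ltW.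
split; first nra.
rewrite (_ : a * (b * (x * y)) = (a * x) * (b * y)); last by ring.
by rewrite mulr_ile1.
Qed.

Lemma marginal_utilityE (g x : R) : marginal_utility g x = g * expR (- g * x).
Proof.
rewrite /marginal_utility /utility derive1E.
have lin : is_derive x 1 (fun y : R => - g * y) (- g).
  have := is_deriveZ (- g) (is_derive_id x (1 : R)).
  by rewrite /GRing.scale/= mulr1.
have [_ ->] := is_deriveN (is_derive1_comp (is_derive_expR (- g * x)) lin).
by rewrite mulrN opprK mulrC.
Qed.

End elementary.

(** * Measures with a density and restrictions to a coarser sigma-algebra *)

Lemma rv_integrable_measurable {R : realType} {disp : measure_display}
    {Omega : measurableType disp} (P : probability Omega R) (X : Omega -> R) :
  rv_integrable P X -> measurable_fun setT X.
Proof. by move=> /measurable_int /measurable_EFinP. Qed.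

Section density_measure.
Context {R : realType} {disp : measure_display} {Omega : measurableType disp}.
Variables (P : probability Omega R) (X : Omega -> R).
Hypotheses (X_ge0 : forall w, 0 <= X w) (iX : rv_integrable P X).
Local Open Scope ereal_scope.

(** The proofs are arguments so that the measure structure of the result can be
    inferred from the term alone. *)
Definition density_measure
  (_ : forall w, (0 <= X w)%R) (_ : rv_integrable P X) (A : set Omega) :=
  \int[P]_(w in A) (X w)%:E.

Local Notation nu := (density_measure X_ge0 iX).

Let nu0 : nu set0 = 0. Proof. exact: integral_set0. Qed.

Let nu_ge0 A : 0 <= nu A.
Proof. by apply: integral_ge0 => w _; rewrite lee_fin. Qed.

Let nu_sigma_additive : semi_sigma_additive nu.
Proof.
apply: semi_sigma_additive_nng_induced.
  exact/measurable_EFinP/(rv_integrable_measurable iX).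
by move=> w; rewrite lee_fin.
Qed.

HB.instance Definition _ := isMeasure.Build _ _ _ nu nu0 nu_ge0
  nu_sigma_additive.

Let nu_finite : fin_num_fun nu.
Proof.
move=> A mA; apply: integrable_fin_num => //.
exact: (integrableS measurableT).
Qed.

HB.instance Definition _ := @Measure_isFinite.Build _ _ _ nu nu_finite.

Lemma density_measure_dominates : nu `<< P.
Proof.
apply/null_content_dominatesP => A mA PA0; apply: null_set_integral => //.
apply: measurable_funTS.
exact/measurable_EFinP/(rv_integrable_measurable iX).
Qed.

(** X agrees almost everywhere with the Radon-Nikodym derivative of the measure
    that it defines, so this is an instance of the change of variables for
    such derivatives. *)
Lemma ge0_integral_density (Z : Omega -> R) A :
  measurable A -> measurable_fun setT Z -> (forall w, (0 <= Z w)%R) ->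
  \int[P]_(w in A) (Z w * X w)%:E = \int[nu]_(w in A) (Z w)%:E.
Proof.
move=> mA mZ Z0; pose f := Radon_Nikodym_SigmaFinite.f nu P.
have dom := density_measure_dominates.
have fi : P.-integrable setT f by exact: Radon_Nikodym_SigmaFinite.f_integrable.
have fX : ae_eq P setT f (EFin \o X).
  apply: integral_ae_eq => //.
    exact/measurable_EFinP/(rv_integrable_measurable iX).
  move=> E _ mE; rewrite -(Radon_Nikodym_SigmaFinite.f_integral dom)//.
have mZE : measurable_fun A (EFin \o Z).
  by apply: measurable_funTS; exact/measurable_EFinP.
rewrite -(Radon_Nikodym_SigmaFinite.change_of_variables dom)//.
apply: ae_eq_integral => //.
- apply: measurable_funTS; apply/measurable_EFinP; apply: measurable_funM => //.
  exact: rv_integrable_measurable iX.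
- apply: emeasurable_funM => //.
  by apply: measurable_funTS; exact: measurable_int fi.
- by move: fX; apply: filterS => w /(_ I) /= fw _; rewrite EFinM -fw.
Qed.

End density_measure.

Section coarse_measure.
Context {R : realType} {disp : measure_display} {Omega : measurableType disp}.
Variables (G : set (set Omega)) (mu : {finite_measure set Omega -> \bar R}).
Hypotheses (sG : sigma_algebra setT G) (Gm : G `<=` measurable).
Local Open Scope ereal_scope.
Local Notation OmegaG := (g_sigma_algebraType G).

Lemma coarse_measurableE : (measurable : set (set OmegaG)) = G.
Proof. exact: measurable_g_measurableTypeE. Qed.

(** The same set function as mu, on the measurable space whose measurable sets
    are those of G; the proofs are arguments so that the measure structure can
    be inferred. *)
Definition coarse_measure (_ : sigma_algebra setT G) (_ : G `<=` measurable)
  : set OmegaG -> \bar R := mu.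

Local Notation muG := (coarse_measure sG Gm).

Let muG0 : muG set0 = 0. Proof. exact: measure0. Qed.

Let muG_ge0 A : 0 <= muG A. Proof. exact: measure_ge0. Qed.

Lemma coarse_measurable (A : set OmegaG) :
  measurable A -> measurable (A : set Omega).
Proof. by rewrite coarse_measurableE => /Gm. Qed.

Let muG_sigma_additive : semi_sigma_additive muG.
Proof.
move=> F mF tF mUF; apply: measure_semi_sigma_additive => //.
  by move=> i; exact: coarse_measurable.
exact: coarse_measurable.
Qed.

HB.instance Definition _ := isMeasure.Build _ _ _ muG muG0 muG_ge0
  muG_sigma_additive.

Let muG_finite : fin_num_fun muG.
Proof. by move=> A /coarse_measurable mA; exact: fin_num_measure. Qed.

HB.instance Definition _ := @Measure_isFinite.Build _ _ _ muG muG_finite.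

Lemma coarse_id_measurable :
  measurable_fun [set: Omega] (id : Omega -> OmegaG).
Proof. by move=> _ A /coarse_measurable mA; rewrite setTI. Qed.

Lemma coarse_measurable_fun d (T : measurableType d) (f : OmegaG -> T) :
  measurable_fun setT f -> measurable_fun [set: Omega] f.
Proof. by move=> mf; exact: (measurableT_comp mf coarse_id_measurable). Qed.

(** The restricted measure is the image of mu under the identity map from the
    fine to the coarse space. *)
Lemma ge0_integral_coarse A (f : OmegaG -> \bar R) :
  G A -> measurable_fun setT f -> (forall w, 0 <= f w) ->
  \int[muG]_(w in A) f w = \int[mu]_(w in A) f w.
Proof.
move=> GA mf f0.
rewrite -[LHS]/(\int[pushforward mu (id : Omega -> OmegaG)]_(w in A) f w).
rewrite ge0_integral_pushforward//.
- exact: coarse_id_measurable.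
- by rewrite coarse_measurableE.
- exact: measurable_funTS.
Qed.

Lemma integrable_coarse (f : OmegaG -> \bar R) :
  measurable_fun setT f ->
  muG.-integrable setT f <-> mu.-integrable [set: Omega] f.
Proof.
have GT : G setT by rewrite -coarse_measurableE; exact: measurableT.
move=> mf; split => /integrableP[_ fi]; apply/integrableP; split => //.
- exact: coarse_measurable_fun.
- move: fi; rewrite ge0_integral_coarse//.
  exact: measurableT_comp.
- move: fi; rewrite -ge0_integral_coarse//.
  exact: measurableT_comp.
Qed.

Lemma integral_coarse A (f : OmegaG -> \bar R) :
  G A -> mu.-integrable [set: Omega] f -> measurable_fun setT f ->
  \int[muG]_(w in A) f w = \int[mu]_(w in A) f w.
Proof.
move=> GA fi mf; rewrite integralE [RHS]integralE.
by rewrite !ge0_integral_coarse//;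
  [exact: measurable_funeneg|exact: measurable_funepos].
Qed.

Lemma ae_coarse (p : Omega -> Prop) : {ae muG, forall w, p w} ->
  {ae mu, forall w, p w}.
Proof.
by move=> [N [mN N0 pN]]; exists N; split => //; exact: coarse_measurable.
Qed.

End coarse_measure.

(** * Conditional expectation *)

Lemma ae_and d (T : measurableType d) (R : realType)
    (mu : {measure set T -> \bar R}) (p q : T -> Prop) :
  {ae mu, forall w, p w} -> {ae mu, forall w, q w} ->
  {ae mu, forall w, p w /\ q w}.
Proof. by apply: filterS2. Qed.

Section conditional_expectation_theory.
Context {R : realType} {disp : measure_display} {Omega : measurableType disp}.
Variables (P : probability Omega R) (G : set (set Omega)).
Hypotheses (sG : sigma_algebra setT G) (Gm : G `<=` measurable).
Implicit Types X Y Z : Omega -> R.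
Local Notation OmegaG := (g_sigma_algebraType G).
Local Notation PG := (coarse_measure P sG Gm).

Lemma rv_wrtP X : rv_wrt G X <-> measurable_fun [set: OmegaG] X.
Proof.
split=> [GX _ B mB|mX B mB].
  by rewrite setTI coarse_measurableE//; exact: GX.
by rewrite -(coarse_measurableE sG) -[_ @^-1` _]setTI; exact: mX.
Qed.

Lemma rv_wrt_measurable X : rv_wrt G X -> measurable_fun [set: Omega] X.
Proof. by move=> GX _ B mB; rewrite setTI; apply: Gm; exact: GX. Qed.

Lemma rv_integrableS X A : measurable A -> rv_integrable P X ->
  P.-integrable A (EFin \o X).
Proof. by move=> mA; exact: integrableS. Qed.

Lemma rv_integrableB X Y : rv_integrable P X -> rv_integrable P Y ->
  rv_integrable P (X \- Y).
Proof.
move=> iX iY; have := integrableB measurableT iX iY.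
by apply: eq_integrable => // w _ /=; rewrite EFinB.
Qed.

Lemma rv_integrableZ (r : R) X : rv_integrable P X ->
  rv_integrable P (fun w => r * X w).
Proof.
move=> iX; have := integrableZl measurableT r iX.
by apply: eq_integrable => // w _ /=; rewrite EFinM.
Qed.

Lemma ae_eq_rv_integral X Y A : measurable A ->
  measurable_fun setT X -> measurable_fun setT Y ->
  {ae P, forall w, X w = Y w} ->
  (\int[P]_(w in A) (X w)%:E = \int[P]_(w in A) (Y w)%:E)%E.
Proof.
move=> mA mX mY XY; apply: ae_eq_integral => //.
- by apply/measurable_EFinP; exact: measurable_funTS.
- by apply/measurable_EFinP; exact: measurable_funTS.
- by apply: filterS XY => w XYw _ /=; rewrite XYw.
Qed.

Lemma ae_le_integrable X Y : measurable_fun setT X -> rv_integrable P Y ->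
  {ae P, forall w, `|X w| <= Y w} -> rv_integrable P X.
Proof.
move=> mX iY XY; have mY := rv_integrable_measurable iY.
apply/integrableP; split; first exact/measurable_EFinP.
move/integrableP : iY => [_]; apply: le_lt_trans.
apply: ae_ge0_le_integral => //.
- by apply: measurableT_comp => //; exact/measurable_EFinP.
- by apply: measurableT_comp => //; exact/measurable_EFinP.
- apply: filterS XY => w XYw _ /=; rewrite lee_fin.
  exact: le_trans XYw (ler_norm _).
Qed.

Lemma ae_eq_integrable X Y : measurable_fun setT Y -> rv_integrable P X ->
  {ae P, forall w, X w = Y w} -> rv_integrable P Y.
Proof.
move=> mY iX XY; apply: (ae_le_integrable mY (integrable_norm iX)).
by apply: filterS XY => w /= ->.
Qed.

Lemma is_condexp_eq X X' Y : is_condexp P G X Y -> measurable_fun setT X' ->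
  {ae P, forall w, X w = X' w} -> is_condexp P G X' Y.
Proof.
move=> [iX iY GY XY] mX' XX'; split=> //; first exact: ae_eq_integrable iX XX'.
move=> A GA; rewrite XY//; apply: ae_eq_rv_integral => //; first exact: Gm.
exact: rv_integrable_measurable iX.
Qed.

(** Two versions have the same integral over every set of G, hence agree almost
    everywhere for the restriction of P to G. *)
Lemma is_condexp_unique X Y Y' : is_condexp P G X Y -> is_condexp P G X Y' ->
  {ae P, forall w, Y w = Y' w}.
Proof.
move=> [iX iY GY XY] [_ iY' GY' XY'].
have mY : measurable_fun [set: OmegaG] (EFin \o Y).
  by apply/measurable_EFinP/rv_wrtP.
have mY' : measurable_fun [set: OmegaG] (EFin \o Y').
  by apply/measurable_EFinP/rv_wrtP.
apply: (@ae_coarse _ _ _ G P sG Gm).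
suff : ae_eq PG setT (EFin \o Y) (EFin \o Y').
  by apply: filterS => w /(_ I) [].
apply: integral_ae_eq => //; first exact/integrable_coarse.
move=> E _; rewrite coarse_measurableE// => GE.
rewrite (integral_coarse sG Gm GE iY mY) (integral_coarse sG Gm GE iY' mY').
by rewrite XY// XY'.
Qed.

Lemma is_condexpB X1 X2 Y1 Y2 : is_condexp P G X1 Y1 -> is_condexp P G X2 Y2 ->
  is_condexp P G (X1 \- X2) (Y1 \- Y2).
Proof.
move=> [iX1 iY1 GY1 XY1] [iX2 iY2 GY2 XY2]; split.
- exact: rv_integrableB.
- exact: rv_integrableB.
- by apply/rv_wrtP/measurable_funB; exact/rv_wrtP.
- move=> A GA; have mA := Gm GA.
  under eq_integral do rewrite EFinB.
  rewrite integralB_EFin//; [|exact: rv_integrableS..].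
  under [RHS]eq_integral do rewrite EFinB.
  rewrite integralB_EFin//; [|exact: rv_integrableS..].
  by rewrite XY1// XY2.
Qed.

(** Y is the derivative, on the coarse space, of the restricted measure X P with
    respect to the restricted P.  The change of variables for that derivative
    and the one for the density X compute the same integral of Z, which gives
    the pull-out property together with existence. *)
Lemma ge0_condexp_density X : (forall w, 0 <= X w) -> rv_integrable P X ->
  exists Y, [/\ forall w, 0 <= Y w, is_condexp P G X Y &
    forall Z A, rv_wrt G Z -> (forall w, 0 <= Z w) -> G A ->
    (\int[P]_(w in A) (Z w * Y w)%:E = \int[P]_(w in A) (Z w * X w)%:E)%E].
Proof.
move=> X0 iX.
pose nu : {finite_measure set Omega -> \bar R} := density_measure X0 iX.
pose nuG : {finite_measure set OmegaG -> \bar R} := coarse_measure nu sG Gm.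
have dom : nuG `<< PG.
  apply/null_content_dominatesP => A /(coarse_measurable sG Gm) mA PA0.
  have /null_content_dominatesP := density_measure_dominates X0 iX.
  exact.
pose f := Radon_Nikodym_SigmaFinite.f nuG PG.
have f0 w : (0 <= f w)%E by exact: Radon_Nikodym_SigmaFinite.f_ge0.
have ffin w : f w \is a fin_num by exact: Radon_Nikodym_SigmaFinite.f_fin_num.
have fi : PG.-integrable setT f.
  exact: Radon_Nikodym_SigmaFinite.f_integrable.
have mf := measurable_int _ fi.
have fE w : (fine (f w))%:E = f w by exact: (fineK (ffin w)).
have EfE : EFin \o (fine \o f) = f by apply/funext => w; exact: fE.
have mY : measurable_fun [set: OmegaG] (fine \o f).
  by apply/measurable_EFinP; rewrite EfE.
have key Z A : rv_wrt G Z -> (forall w, 0 <= Z w) -> G A ->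
    (\int[P]_(w in A) (Z w * (fine \o f) w)%:E =
     \int[P]_(w in A) (Z w * X w)%:E)%E.
  move=> GZ Z0 GA; have mZ : measurable_fun [set: OmegaG] Z by exact/rv_wrtP.
  have mA : measurable (A : set OmegaG) by rewrite coarse_measurableE.
  rewrite (ge0_integral_density X0 iX (Gm GA) (rv_wrt_measurable GZ) Z0).
  rewrite -/nu -(@ge0_integral_coarse _ _ _ G nu sG Gm)//; last first.
    exact/measurable_EFinP.
  rewrite -(Radon_Nikodym_SigmaFinite.change_of_variables dom)//; last first.
    by apply/measurable_EFinP; exact: measurable_funTS.
  rewrite ge0_integral_coarse//.
  - by apply: eq_integral => w _; rewrite EFinM fE.
  - by apply: emeasurable_funM => //; exact/measurable_EFinP.
  - by move=> w; rewrite mule_ge0// lee_fin.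
exists (fine \o f); split=> //.
- by move=> w; exact: fine_ge0.
- split=> //.
  + rewrite /rv_integrable EfE.
    exact/(@integrable_coarse _ _ _ G P sG Gm).
  + exact/rv_wrtP.
  + move=> A GA; have := key (cst 1) A.
    under eq_integral do rewrite mul1r.
    under [in X in _ -> _ -> _ -> _ = X]eq_integral do rewrite mul1r.
    apply=> //; apply/rv_wrtP; exact: measurable_cst.
Qed.

Lemma condexpP X : rv_integrable P X -> is_condexp P G X (condexp P G X).
Proof.
move=> iX; suff XY : exists Y, is_condexp P G X Y.
  exact: (@xgetPex _ (cst 0) [set Y | is_condexp P G X Y]).
have ip : rv_integrable P (X ^\+)%R.
  exact: (integrable_funrpos measurableT iX).
have im : rv_integrable P (X ^\-)%R.
  exact: (integrable_funrneg measurableT iX).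
have [Yp [_ XYp _]] := ge0_condexp_density (funrpos_ge0 X) ip.
have [Ym [_ XYm _]] := ge0_condexp_density (funrneg_ge0 X) im.
exists (Yp \- Ym); have -> : X = (X ^\+ \- X ^\-)%R.
  by rewrite -[LHS]funrposBneg.
exact: is_condexpB.
Qed.

Lemma condexp_ae X Y : is_condexp P G X Y ->
  {ae P, forall w, condexp P G X w = Y w}.
Proof.
by move=> XY; apply: (is_condexp_unique _ XY); apply: condexpP; case: XY.
Qed.

(** The positive and the negative part of Z are each a case of the density
    formula for the nonnegative version Y0; being bounded by the absolute value
    of Z, they inherit integrability against X. *)
Lemma is_condexpM X Y Z : (forall w, 0 <= X w) -> is_condexp P G X Y ->
  rv_wrt G Z -> rv_integrable P (Z \* X) ->
  is_condexp P G (Z \* X) (Z \* Y).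
Proof.
move=> X0 XY GZ iZX; have [iX iY GY _] := XY.
have mX := rv_integrable_measurable iX.
have [Y0 [Y0_ge0 XY0 key]] := ge0_condexp_density X0 iX.
have ge0_case Z' : rv_wrt G Z' -> (forall w, 0 <= Z' w) ->
    (forall w, Z' w <= `|Z w|) -> is_condexp P G (Z' \* X) (Z' \* Y0).
  move=> GZ' Z'0 Z'Z; have mZ' := rv_wrt_measurable GZ'.
  have iZ'X : rv_integrable P (Z' \* X).
    apply: (ae_le_integrable _ (integrable_norm iZX)).
      exact: measurable_funM.
    apply: aeW => w /=; rewrite !normrM ger0_norm// ler_wpM2r//.
  have GZ'Y : rv_wrt G (Z' \* Y0).
    apply/rv_wrtP; apply: measurable_funM; first exact/rv_wrtP.
    by apply/rv_wrtP; case: XY0.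
  have GT : G setT by rewrite -(coarse_measurableE sG); exact: measurableT.
  split=> //; last by move=> A GA; rewrite /= key.
  apply/integrableP; split; first exact/measurable_EFinP/rv_wrt_measurable.
  move/integrableP : iZ'X => [_]; apply: le_lt_trans.
  rewrite (eq_integral (fun w => (Z' w * Y0 w)%:E)); last first.
    by move=> w _ /=; rewrite ger0_norm// mulr_ge0.
  rewrite key// le_eqVlt; apply/orP; left; apply/eqP.
  by apply: eq_integral => w _ /=; rewrite ger0_norm// mulr_ge0.
have mZ : measurable_fun [set: OmegaG] Z by exact/rv_wrtP.
have Zp : is_condexp P G ((Z ^\+)%R \* X) ((Z ^\+)%R \* Y0).
  apply: ge0_case; first exact/rv_wrtP/measurable_funrpos.
    exact: funrpos_ge0.
  by move=> w; rewrite /funrpos ge_max ler_norm normr_ge0.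
have Zm : is_condexp P G ((Z ^\-)%R \* X) ((Z ^\-)%R \* Y0).
  apply: ge0_case; first exact/rv_wrtP/measurable_funrneg.
    exact: funrneg_ge0.
  by move=> w; rewrite /funrneg ge_max -normrN ler_norm normr_ge0.
have ZE V : (Z ^\+)%R \* V \- (Z ^\-)%R \* V = Z \* V.
  by apply/funext => w /=; rewrite -mulrBl -[in RHS](funrposBneg Z).
have ZY0 : is_condexp P G (Z \* X) (Z \* Y0).
  by rewrite -(ZE X) -(ZE Y0); exact: is_condexpB.
have YY0 : {ae P, forall w, (Z \* Y0) w = (Z \* Y) w}.
  by apply: filterS (is_condexp_unique XY0 XY) => w /= ->.
have GZY : rv_wrt G (Z \* Y).
  by apply/rv_wrtP/measurable_funM => //; exact/rv_wrtP.
case: ZY0 => _ iZY0 GZY0 ZXY0; split=> //.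
  exact: ae_eq_integrable (rv_wrt_measurable GZY) iZY0 YY0.
move=> A GA; rewrite -ZXY0//; apply/esym/ae_eq_rv_integral => //.
- exact: Gm.
- exact: rv_wrt_measurable.
- exact: rv_wrt_measurable.
Qed.

(** On the set of G where Y is nonpositive the positive variable X has
    nonpositive integral, so that this set is null. *)
Lemma condexp_gt0 X Y : (forall w, 0 < X w) -> is_condexp P G X Y ->
  {ae P, forall w, 0 < Y w}.
Proof.
move=> X0 [iX iY GY XY]; pose A := [set w | Y w <= 0].
have GA : G A.
  have -> : A = Y @^-1` `]-oo, 0].
    by apply/seteqP; split => w; rewrite /= in_itv.
  exact: GY.
have mA := Gm GA.
have XA0 : (\int[P]_(w in A) (X w)%:E = 0)%E.
  apply/eqP; rewrite eq_le; apply/andP; split.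
    rewrite -XY// -[leRHS](@integral0 _ _ _ P A); apply: le_integral => //.
    - exact: rv_integrableS.
    - exact: integrable0.
    - by move=> w /set_mem Yw /=; rewrite lee_fin.
  by apply: integral_ge0 => w _; rewrite lee_fin ltW.
have mX : measurable_fun A (EFin \o X).
  by apply/measurable_EFinP/measurable_funTS/(rv_integrable_measurable iX).
have /(ae_eq_integral_abs P mA mX) : (\int[P]_(w in A) `|(X w)%:E| = 0)%E.
  by rewrite -XA0; apply: eq_integral => w _ /=; rewrite ger0_norm// ltW.
apply: filterS => w AX0; rewrite ltNge; apply/negP => /AX0 /= [Xw0].
by have := X0 w; rewrite Xw0 ltxx.
Qed.

Lemma ae_le_rv_integral X Y A : measurable A ->
  rv_integrable P X -> rv_integrable P Y -> {ae P, forall w, X w <= Y w} ->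
  (\int[P]_(w in A) (X w)%:E <= \int[P]_(w in A) (Y w)%:E)%E.
Proof.
move=> mA iX iY XY.
have [mX mY] := (rv_integrable_measurable iX, rv_integrable_measurable iY).
have mXY : measurable_fun setT (fun w => Num.min (X w) (Y w)).
  exact: measurable_minr.
have XE : {ae P, forall w, X w = Num.min (X w) (Y w)}.
  by apply: filterS XY => w XYw; rewrite min_l.
rewrite (ae_eq_rv_integral mA mX mXY XE); apply: le_integral => //.
- by apply: rv_integrableS => //; exact: ae_eq_integrable iX XE.
- exact: rv_integrableS.
- by move=> w _; rewrite lee_fin ge_min lexx orbT.
Qed.

Lemma rv_wrt_comp X (f : R -> R) :
  measurable_fun setT f -> rv_wrt G X -> rv_wrt G (fun w => f (X w)).
Proof. by move=> mf /rv_wrtP mX; apply/rv_wrtP; exact: measurableT_comp. Qed.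

Lemma rv_wrt_comp2 X Y (f : R * R -> R) : measurable_fun setT f ->
  rv_wrt G X -> rv_wrt G Y -> rv_wrt G (fun w => f (X w, Y w)).
Proof.
move=> mf /rv_wrtP mX /rv_wrtP mY; apply/rv_wrtP.
by apply: (measurableT_comp mf); exact: measurable_fun_pair.
Qed.

Lemma rv_wrt_cst (r : R) : rv_wrt G (fun=> r).
Proof. by apply/rv_wrtP; exact: measurable_cst. Qed.

Lemma rv_wrtD X Y : rv_wrt G X -> rv_wrt G Y -> rv_wrt G (fun w => X w + Y w).
Proof. by move=> /rv_wrtP mX /rv_wrtP mY; apply/rv_wrtP/measurable_funD. Qed.

Lemma rv_wrtB X Y : rv_wrt G X -> rv_wrt G Y -> rv_wrt G (fun w => X w - Y w).
Proof. by move=> /rv_wrtP mX /rv_wrtP mY; apply/rv_wrtP/measurable_funB. Qed.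

Lemma rv_wrtM X Y : rv_wrt G X -> rv_wrt G Y -> rv_wrt G (fun w => X w * Y w).
Proof. by move=> /rv_wrtP mX /rv_wrtP mY; apply/rv_wrtP/measurable_funM. Qed.

Lemma rv_wrtN X : rv_wrt G X -> rv_wrt G (fun w => - X w).
Proof. exact: (rv_wrt_comp (@oppr_measurable R setT)). Qed.

Lemma rv_wrt_indic A : G A -> rv_wrt G (\1_A : Omega -> R).
Proof.
by move=> GA; apply/rv_wrtP/measurable_indic; rewrite coarse_measurableE.
Qed.

Lemma integral_indicM X A B : measurable A -> measurable B ->
  (\int[P]_(w in B) (X w * \1_A w)%:E = \int[P]_(w in B `&` A) (X w)%:E)%E.
Proof.
move=> mA mB; rewrite integral_mkcondr; apply: eq_integral => w _.
rewrite patchE indicE; case: ifPn => wA; first by rewrite mulr1.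
by rewrite mulr0.
Qed.

Lemma integrable_indicM X A : measurable A -> rv_integrable P X ->
  rv_integrable P (X \* \1_A).
Proof.
move=> mA iX; apply: (ae_le_integrable _ (integrable_norm iX)).
  apply: measurable_funM; first exact: rv_integrable_measurable iX.
  exact: measurable_indic.
apply: aeW => w /=; rewrite normrM indicE.
by case: (_ \in _); rewrite ?normr1 ?mulr1// normr0 mulr0.
Qed.

Lemma is_condexp_eq_integral X1 X2 Y1 Y2 :
  is_condexp P G X1 Y1 -> is_condexp P G X2 Y2 ->
  (forall A, G A ->
    (\int[P]_(w in A) (X1 w)%:E = \int[P]_(w in A) (X2 w)%:E)%E) ->
  {ae P, forall w, Y1 w = Y2 w}.
Proof.
move=> [iX1 iY1 GY1 XY1] XY2 X12; apply: (is_condexp_unique _ XY2).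
by case: XY2 => iX2 _ _ _; split => // A GA; rewrite XY1// X12.
Qed.

Lemma is_condexp_indep A : measurable A ->
  (forall B, G B -> P (B `&` A) = (P B * P A)%E) ->
  is_condexp P G \1_A (fun=> fine (P A)).
Proof.
move=> mA indep; split.
- exact: integrable_indic.
- exact: finite_measure_integrable_cst.
- exact: rv_wrt_cst.
- move=> B GB; have mB := Gm GB.
  rewrite integral_cst// integral_indic// fineK ?fin_num_measure// muleC setIC.
  exact/esym/indep.
Qed.

End conditional_expectation_theory.

Lemma rv_wrtS {R : realType} {disp : measure_display}
    {Omega : measurableType disp} (G H : set (set Omega)) (X : Omega -> R) :
  G `<=` H -> rv_wrt G X -> rv_wrt H X.
Proof. by move=> GH GX B mB; apply: GH; exact: GX. Qed.

Section tower.
Context {R : realType} {disp : measure_display} {Omega : measurableType disp}.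
Variables (P : probability Omega R) (G H : set (set Omega)).
Hypotheses (sG : sigma_algebra setT G) (sH : sigma_algebra setT H).
Hypotheses (GH : G `<=` H) (Hm : H `<=` measurable).

(** The tower property, localized on an event of the finer sigma-algebra. *)
Lemma condexp_tower_indic (X V : Omega -> R) A :
  is_condexp P H X V -> H A ->
  {ae P, forall w,
    condexp P G (X \* \1_A) w = condexp P G (V \* \1_A) w}.
Proof.
move=> [iX iV HV XV] HA; have Gm := subset_trans GH Hm.
have mA := Hm HA.
have XY := condexpP sG Gm (integrable_indicM mA iX).
have VY := condexpP sG Gm (integrable_indicM mA iV).
apply: (is_condexp_eq_integral sG Gm XY VY) => B GB; have mB := Gm _ GB.
rewrite !integral_indicM// XV//.
have : (measurable : set (set (g_sigma_algebraType H))) (B `&` A).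
  by apply: measurableI; rewrite coarse_measurableE//; exact: GH.
by rewrite coarse_measurableE.
Qed.

End tower.

(** * Adaptedness and the driving random walk *)

Section market_facts.
Context {R : realType} {disp : measure_display} {Omega : measurableType disp}.
Variables (P : probability Omega R) (M : market R Omega).
Hypothesis market_hyp : market_axioms P M.
Local Notation N := (nsteps M).
Local Notation F := (filtration M).
Local Notation h := (step M).

Let Fs k (kN : (k <= N)%N) : sigma_algebra [set: Omega] (F k).
Proof. exact: filtration_sigma (market_filtration market_hyp) k kN. Qed.

Let Fm k (kN : (k <= N)%N) : F k `<=` measurable.
Proof. exact: filtration_sub (market_filtration market_hyp) k kN. Qed.

Lemma filtrationW j k : (j <= k <= N)%N -> F j `<=` F k.
Proof. exact: filtration_mono (market_filtration market_hyp) j k. Qed.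

Lemma rv_wrt_filtration (X : Omega -> R) j k :
  (j <= k <= N)%N -> rv_wrt (F j) X -> rv_wrt (F k) X.
Proof. by move=> /filtrationW FjFk; exact: rv_wrtS. Qed.

Lemma rv_wrt_filtrationS (X : Omega -> R) k :
  (k < N)%N -> rv_wrt (F k) X -> rv_wrt (F k.+1) X.
Proof. by move=> kN; apply: rv_wrt_filtration; rewrite leqnSn. Qed.

Lemma step_gt0 : 0 < h.
Proof.
by rewrite divr_gt0 ?ltr0n ?(horizon_gt0 market_hyp) ?(nsteps_gt0 market_hyp).
Qed.

Lemma incr_walk_adapted i k : (k < N)%N -> rv_wrt (F k.+1) (incr (walk M i) k).
Proof.
move=> kN; have wa := walk_adapted (market_walk market_hyp).
apply: rv_wrtB; [exact: Fs|exact: wa|].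
by apply: rv_wrt_filtrationS => //; apply: wa; exact: ltnW.
Qed.

Lemma return_c_adapted k : (k < N)%N -> rv_wrt (F k.+1) (return_c M k).
Proof.
move=> kN; have S := Fs kN.
have W X := @rv_wrt_filtrationS X k kN.
apply: rv_wrtD => //; apply: rv_wrtM => //.
- by apply: W; exact: (mu_c_adapted market_hyp).
- exact: rv_wrt_cst.
- apply: rv_wrtM => //; last exact: rv_wrt_cst.
  by apply: W; exact: (sigma_c_adapted market_hyp).
- exact: incr_walk_adapted.
Qed.

Lemma return_s_adapted k : (k < N)%N -> rv_wrt (F k.+1) (return_s M k).
Proof.
move=> kN; have S := Fs kN.
have W X := @rv_wrt_filtrationS X k kN.
have cst r : rv_wrt (F k.+1) (fun=> r) by exact: rv_wrt_cst.
apply: rv_wrtD => //; apply: rv_wrtM => //.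
- by apply: W; exact: (mu_s_adapted market_hyp).
- by apply: rv_wrtM => //; apply: W; exact: (sigma_s_adapted market_hyp).
- by apply: rv_wrtD => //; apply: rv_wrtM => //; exact: incr_walk_adapted.
Qed.

Lemma asset_c_adapted k : (k <= N)%N -> rv_wrt (F k) (asset_c M k).
Proof.
elim: k => [|k IH] kN /=; first exact: (rv_wrt_cst (Fs kN)).
have Ck : rv_wrt (F k.+1) (asset_c M k).
  exact/rv_wrt_filtrationS/IH/ltnW.
have S := Fs kN.
by apply: rv_wrtD => //; apply: rv_wrtM => //; exact: return_c_adapted.
Qed.

Lemma asset_s_adapted k : (k <= N)%N -> rv_wrt (F k) (asset_s M k).
Proof.
elim: k => [|k IH] kN /=; first exact: (rv_wrt_cst (Fs kN)).
have Sk : rv_wrt (F k.+1) (asset_s M k).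
  exact/rv_wrt_filtrationS/IH/ltnW.
have S := Fs kN.
by apply: rv_wrtD => //; apply: rv_wrtM => //; exact: return_s_adapted.
Qed.

Lemma dividend_paid_adapted k : (k < N)%N -> rv_wrt (F k) (dividend_paid M k).
Proof.
move=> kN; have S := Fs (ltnW kN).
apply: rv_wrtM => //; last exact: rv_wrt_cst.
apply: (rv_wrt_comp2 S (dividend_measurable market_hyp kN)).
- exact/asset_c_adapted/ltnW.
- exact/asset_s_adapted/ltnW.
Qed.

Lemma wealth_adapted pi k : adapted_before M N (in_asset pi) ->
  adapted_before M N (in_derivative pi) ->
  (k <= N)%N -> rv_wrt (F k) (wealth M pi k).
Proof.
move=> Aa Ab; elim: k => [|k IH] kN /=.
  exact: (initial_wealth_measurable market_hyp).
have S := Fs kN.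
have W X := @rv_wrt_filtrationS X k kN.
have Dk := price_adapted market_hyp.
apply: rv_wrtD => //; first exact/W/IH/ltnW.
apply: rv_wrtD => //; apply: rv_wrtM => //.
- by apply: W; exact: Aa.
- exact: return_c_adapted.
- by apply: W; exact: Ab.
- apply: rv_wrtD => //; last by apply: W; exact: dividend_paid_adapted.
  by apply: rv_wrtB => //; [exact: Dk|apply: W; exact/Dk/ltnW].
Qed.

Lemma final_wealth_adapted pi : adapted_before M N (in_asset pi) ->
  adapted_before M N (in_derivative pi) -> rv_wrt (F N) (final_wealth M pi).
Proof.
move=> Aa Ab; apply: rv_wrtD; first exact: Fs.
  exact: wealth_adapted.
exact: income_measurable market_hyp.
Qed.

Lemma gamma0_adapted k : (k <= N)%N -> rv_wrt (F k) (gamma0 M).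
Proof.
move=> kN; apply: (@rv_wrt_filtration _ 0%N) => //.
exact: (gamma_adapted market_hyp).
Qed.

(** The up and down events are the cases e = 1 and e = -1; they can then be
    treated together. *)
Definition walk_event (k : nat) (e : R) : set Omega :=
  [set w | incr (b1 M) k w = e].

Lemma walk_event_adapted k e : (k < N)%N -> F k.+1 (walk_event k e).
Proof.
move=> kN; rewrite (_ : walk_event k e = incr (b1 M) k @^-1` [set e])//.
by apply: incr_walk_adapted => //; exact: measurable_set1.
Qed.

Lemma walk_event_measurable k e : (k < N)%N -> measurable (walk_event k e).
Proof. by move=> kN; apply: (Fm kN); exact: walk_event_adapted. Qed.

Lemma indic_walk_event k e w :
  \1_(walk_event k e) w = (incr (b1 M) k w == e)%:R :> R.
Proof.
rewrite indicE; congr (_ %:R); congr nat_of_bool.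
by apply/idP/eqP => [/set_mem|we]; last exact/mem_set.
Qed.

Lemma walk_event_proba k e : (k < N)%N -> e \in [:: 1; -1] ->
  P (walk_event k e) = (2^-1)%:E.
Proof.
move=> kN; rewrite !inE => /orP[] /eqP ->.
- exact: walk_up (market_walk market_hyp) _ _ kN.
- exact: walk_down (market_walk market_hyp) _ _ kN.
Qed.

Lemma walk_event_cover k : (k < N)%N ->
  {ae P, forall w, incr (b1 M) k w = 1 \/ incr (b1 M) k w = -1}.
Proof.
move=> kN; pose U := walk_event k 1 `|` walk_event k (-1).
have mU : measurable U by apply: measurableU; exact: walk_event_measurable.
have PU : P U = 1%E.
  transitivity (P (walk_event k 1) + P (walk_event k (-1)))%E.
    apply: measureU; [exact: walk_event_measurable..|].
    rewrite /walk_event; apply/seteqP; split => // w [/= up down].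
    by exfalso; lra.
  rewrite !walk_event_proba ?inE ?eqxx ?orbT// -EFinD; congr EFin.
  by field.
exists (~` U); split; first exact: measurableC.
  by rewrite probability_setC// PU subee.
by move=> w /= nU; apply: contra_not nU => -[]; [left|right].
Qed.

(** The increment is independent of the past, so conditioning leaves its
    probability unchanged. *)
Lemma condexp_walk_event k e : (k < N)%N -> e \in [:: 1; -1] ->
  {ae P, forall w, condexp P (F k) (\1_(walk_event k e)) w = 2^-1}.
Proof.
move=> kN e1; have mE := walk_event_measurable e kN.
have kN' := ltnW kN.
have := @is_condexp_indep _ _ _ P _ (Fs kN') (Fm kN') _ mE.
rewrite walk_event_proba//= => /(_ _)/(condexp_ae (Fs kN') (Fm kN')); apply.
move=> B FB; rewrite -(walk_event_proba kN e1).
apply: (walk_indep (market_walk market_hyp) kN FB).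
apply: sub_sigma_algebra; rewrite -bigcup_mkord_ord.
exists 0%N => //; exists [set e]; first exact: measurable_set1.
rewrite setTI /walk_event /b1.
have -> // : inord 0 = ord0 :> 'I_(walk_dim M).+2.
by apply/val_inj; rewrite /= inordK.
Qed.

End market_facts.

(** * First order condition for the optimal strategy *)

Section optimality.
Context {R : realType} {disp : measure_display} {Omega : measurableType disp}.
Variables (P : probability Omega R) (M : market R Omega).
Hypothesis market_hyp : market_axioms P M.
Local Notation N := (nsteps M).
Local Notation F := (filtration M).
Local Notation h := (step M).

Definition exp_wealth (pi : strategy R Omega) (w : Omega) : R :=
  expR (- gamma0 M w * final_wealth M pi w).

Lemma exp_wealth_gt0 pi w : 0 < exp_wealth pi w.
Proof. exact: expR_gt0. Qed.

Lemma exp_wealth_integrable pi :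
  rv_integrable P (final_utility M pi) <-> rv_integrable P (exp_wealth pi).
Proof.
have uE : EFin \o final_utility M pi = (\- (EFin \o exp_wealth pi))%E by [].
have eE : EFin \o exp_wealth pi = (\- (EFin \o final_utility M pi))%E.
  by apply/funext => w /=; rewrite opprK.
split; rewrite /rv_integrable => H.
  by rewrite eE; exact: integrableN.
by rewrite uE; exact: integrableN.
Qed.

(** Almost sure domination of the conditional expected utilities integrates to
    an inequality between expectations. *)
Lemma optimal_exp_wealth_le pihat pi : optimal P M pihat ->
  admissible P M pi -> rv_integrable P (exp_wealth pi) ->
  (\int[P]_w (exp_wealth pihat w)%:E <= \int[P]_w (exp_wealth pi w)%:E)%E.
Proof.
move=> [_ ihat pimax] api ipi; have iu := (exp_wealth_integrable pi).2 ipi.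
have FN := market_filtration market_hyp.
have S := filtration_sigma FN (leq0n N).
have Sm := filtration_sub FN (leq0n N).
have [_ ihat' _ hatE] := condexpP S Sm ihat.
have [_ iu' _ uE] := condexpP S Sm iu.
have F0T : F 0%N setT.
  by rewrite -(coarse_measurableE S); exact: measurableT.
have := ae_le_rv_integral measurableT iu' ihat' (pimax _ api iu).
rewrite (uE _ F0T) (hatE _ F0T).
have intN pi' : (\int[P]_w (final_utility M pi' w)%:E =
    - \int[P]_w (exp_wealth pi' w)%:E)%E.
  by rewrite -integral_ge0N// => w _; rewrite lee_fin ltW// exp_wealth_gt0.
by rewrite !intN leeN2.
Qed.

Definition perturb (pi : strategy R Omega) (k : nat) (th : Omega -> R) :=
  Strategy (fun j w => if j == k then in_asset pi j w + th w
                       else in_asset pi j w) (in_derivative pi).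

Lemma wealth_perturb pi k th j w :
  wealth M (perturb pi k th) j w =
  wealth M pi j w + (if (k < j)%N then th w * return_c M k w else 0).
Proof.
elim: j => [|j IH] /=; first by rewrite addr0.
rewrite IH /wealth_incr /= ltnS; have [jk|kj|->] := ltngtP j k; ring.
Qed.

Lemma exp_wealth_perturb pi k th w : (k < N)%N ->
  exp_wealth (perturb pi k th) w =
  exp_wealth pi w * expR (- (gamma0 M w * (th w * return_c M k w))).
Proof.
move=> kN; rewrite /exp_wealth /final_wealth wealth_perturb kN -expRD.
by congr expR; ring.
Qed.

(** Scaling th by e with |e| at most 1/2 keeps the strategy admissible.
    Optimality and the quadratic bound on exp(- e x), x being the perturbation
    of g W, show that e times the integral below is at most 2 e^2 times the
    expectation of exp(- g W) for both signs of e; hence that integral is 0. *)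
Lemma optimal_first_order pihat k th : optimal P M pihat -> (k < N)%N ->
  rv_wrt (F k) th ->
  {ae P, forall w, `|th w * return_c M k w| <= 1} ->
  {ae P, forall w, `|gamma0 M w * (th w * return_c M k w)| <= 1} ->
  (\int[P]_w (gamma0 M w * (th w * return_c M k w) * exp_wealth pihat w)%:E
   = 0)%E.
Proof.
move=> opt kN Fth th1 th2; have [[Aa Ab iX] ihat _] := opt.
have iE := (exp_wealth_integrable pihat).1 ihat.
have mE := rv_integrable_measurable iE.
have FN := market_filtration market_hyp.
have Sk := filtration_sigma FN (ltnW kN).
have mR := rv_wrt_measurable (filtration_sub FN kN)
  (return_c_adapted market_hyp kN).
have mth := rv_wrt_measurable (filtration_sub FN (ltnW kN)) Fth.
have mg := rv_wrt_measurable (filtration_sub FN (leq0n N))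
  (gamma0_adapted market_hyp (leq0n N)).
pose x w := gamma0 M w * (th w * return_c M k w).
have mx : measurable_fun setT x by do 2 apply: measurable_funM => //.
have iD : rv_integrable P (x \* exp_wealth pihat).
  apply: (ae_le_integrable _ iE); first exact: measurable_funM.
  apply: filterS th2 => w xw /=.
  rewrite normrM (gtr0_norm (exp_wealth_gt0 _ _)).
  by rewrite ler_piMl// ltW// exp_wealth_gt0.
have adm e : `|e| <= 2^-1 ->
    admissible P M (perturb pihat k (fun w => e * th w)).
  move=> e1; split => //.
  - move=> j jN /=; have Sj := filtration_sigma FN (ltnW jN).
    have [->|_] := eqVneq j k; last exact: Aa.
    apply: (rv_wrtD Sk); first exact: Aa.
    by apply: (rv_wrtM Sk) => //; exact: (rv_wrt_cst Sk).
  - move=> j jN.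
    have -> : wealth M (perturb pihat k (fun w => e * th w)) j =
        wealth M pihat j \- (fun w => if (k < j)%N
                             then - (e * th w * return_c M k w) else 0).
      apply/funext => w; rewrite wealth_perturb /=.
      by case: ifP => _; rewrite ?opprK ?subr0 ?addr0.
    apply: rv_integrableB; first exact: iX.
    case: (k < j)%N; last exact: integrable0.
    apply: (@ae_le_integrable _ _ _ _ _ (cst 1)).
    + by apply: measurableT_comp => //; apply: measurable_funM => //;
        exact: measurable_funM.
    + exact: finite_measure_integrable_cst.
    + apply: filterS th1 => w thw /=; rewrite normrN -mulrA normrM.
      have := normr_ge0 (th w * return_c M k w); nra.
have mEp e :
    measurable_fun setT (fun w => exp_wealth pihat w * expR (- (e * x w))).
  apply: measurable_funM => //; apply: measurableT_comp => //.
  by apply: measurableT_comp => //; exact: measurable_funM.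
have Ebound e : `|e| <= 2^-1 -> {ae P, forall w,
    exp_wealth pihat w * expR (- (e * x w)) <=
    exp_wealth pihat w - (e * (x w * exp_wealth pihat w)
                          - 2 * e ^+ 2 * exp_wealth pihat w)}.
  move=> e1; apply: filterS th2 => w; rewrite -/(x w) => xw.
  have ex : `|- (e * x w)| <= 2^-1.
    by rewrite normrN normrM; have := normr_ge0 (x w); have := normr_ge0 e; nra.
  have := expR_le_quadratic ex; have := exp_wealth_gt0 pihat w.
  have : x w ^+ 2 <= 1.
    by rewrite -real_normK ?num_real//; have := normr_ge0 (x w); nra.
  set E := exp_wealth _ _; set y := expR _ => x2 E0 yE.
  have : y <= 1 - e * x w + 2 * e ^+ 2.
    by apply: le_trans yE _; have := sqr_ge0 e; nra.
  nra.
pose m := \int[P]_w exp_wealth pihat w.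
pose d := \int[P]_w (x w * exp_wealth pihat w).
have dE : (\int[P]_w (x w * exp_wealth pihat w)%:E = d%:E)%E.
  by rewrite fineK//; exact: integrable_fin_num.
rewrite dE; congr EFin; apply: (@eq0_quadratic_bound _ m).
  by apply: Rintegral_ge0 => w _; rewrite ltW// exp_wealth_gt0.
move=> e e1.
have iB : rv_integrable P (fun w => e * (x w * exp_wealth pihat w)
                          - 2 * e ^+ 2 * exp_wealth pihat w).
  by apply: rv_integrableB; exact: rv_integrableZ.
have iU := rv_integrableB iE iB.
have ipert : rv_integrable P (exp_wealth (perturb pihat k (fun w => e * th w))).
  have -> : exp_wealth (perturb pihat k (fun w => e * th w)) =
      (fun w => exp_wealth pihat w * expR (- (e * x w))).
    apply/funext => w; rewrite exp_wealth_perturb//.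
    by congr (_ * expR _); rewrite /x; ring.
  apply: (ae_le_integrable (mEp e) iU).
  apply: filterS (Ebound _ e1) => w; apply: le_trans.
  by rewrite ger0_norm// mulr_ge0 ?expR_ge0// ltW// exp_wealth_gt0.
have le1 := optimal_exp_wealth_le opt (adm _ e1) ipert.
have le2 :
    (\int[P]_w (exp_wealth (perturb pihat k (fun w => (e * th w)%R)) w)%:E <=
     \int[P]_w (exp_wealth pihat w - (e * (x w * exp_wealth pihat w)
                          - 2 * e ^+ 2 * exp_wealth pihat w))%:E)%E.
  apply: ae_le_rv_integral => //; apply: filterS (Ebound _ e1) => w.
  apply: le_trans; rewrite exp_wealth_perturb// le_eqVlt; apply/orP; left.
  by apply/eqP; congr (_ * expR _); rewrite /x; ring.
have := le_trans le1 le2.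
have -> : (\int[P]_w (exp_wealth pihat w - (e * (x w * exp_wealth pihat w)
    - 2 * e ^+ 2 * exp_wealth pihat w))%:E
    = (m - (e * d - 2 * e ^+ 2 * m))%:E)%E.
  rewrite -[LHS]fineK; last exact: integrable_fin_num.
  congr EFin; rewrite -[LHS]/(\int[P]_w _) RintegralB//.
  rewrite RintegralB//; [|exact: rv_integrableZ..].
  by rewrite !RintegralZl.
have -> : (\int[P]_w (exp_wealth pihat w)%:E = m%:E)%E.
  by rewrite fineK//; exact: integrable_fin_num.
rewrite lee_fin; lra.
Qed.

End optimality.

(** * The one-step identity of the pricing kernel *)

Section kernel_algebra.
Context {R : realType}.
Implicit Types g sigma q alpha b mu kw : R.

(** The pointwise algebra of one time step, with q for sqrt h: H1, H2 are the
    discounts on the up and down events, and a1, a2 the values of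
    E_k of the kernel weight times the indicator of the event, so that a1 / 2^-1
    and a2 / 2^-1 are its expectations conditional on the event.  The first
    order condition says
      (1 + r q) H1 a1 = (1 - r q) H2 a2;
    since H2 / H1 = exp(2 g alpha sigma q), taking logarithms gives alpha, and
    the sum H1 a1 + H2 a2 is 2 H1 a1 / (1 - r q) = 2 H2 a2 / (1 + r q). *)
Lemma kernel_one_step g sigma q mu alpha b (a1 a2 : R) (r := mu / sigma)
    (H1 := expR (- g * (b + alpha * (mu * q ^+ 2 + sigma * q * 1))))
    (H2 := expR (- g * (b + alpha * (mu * q ^+ 2 + sigma * q * -1)))) :
  0 < g -> 0 < q -> 0 < r -> r * q < 1 ->
  (mu * q ^+ 2 + sigma * q) * (H1 * a1) +
    (mu * q ^+ 2 - sigma * q) * (H2 * a2) = 0 ->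
  0 < H1 * a1 + H2 * a2 ->
  [/\ alpha = (2 * g * sigma * q)^-1 * ln ((1 + r * q) / (1 - r * q)) +
        (2 * g * sigma * q)^-1 * ln (a1 / 2^-1 / (a2 / 2^-1)),
      forall kw, (1 - r * q) * (kw / (a1 / 2^-1)) =
        H1 * kw / (H1 * a1 + H2 * a2) &
      forall kw, (1 + r * q) * (kw / (a2 / 2^-1)) =
        H2 * kw / (H1 * a1 + H2 * a2)].
Proof.
move=> g0 q0 r0 rq1 foc tot.
have s0 : sigma != 0.
  by apply/eqP => s0; move: r0; rewrite /r s0 invr0 mulr0 ltxx.
have muE : mu = r * sigma by rewrite /r divfK.
have H10 : 0 < H1 by exact: expR_gt0.
have H20 : 0 < H2 by exact: expR_gt0.
have rq0 : 0 < r * q by exact: mulr_gt0.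
have foc' : (1 + r * q) * (H1 * a1) = (1 - r * q) * (H2 * a2).
  have sq0 : sigma * q != 0 by rewrite mulf_neq0// gt_eqF.
  apply: (mulfI sq0); apply/eqP; rewrite -subr_eq0; apply/eqP.
  by rewrite -[RHS]foc muE; ring.
have m1 : 0 < H1 * a1 by nra.
have m2 : 0 < H2 * a2 by nra.
have a10 : 0 < a1 by rewrite -(pmulr_rgt0 _ H10).
have a20 : 0 < a2 by rewrite -(pmulr_rgt0 _ H20).
have p0 : 0 < 1 + r * q by lra.
have n0 : 0 < 1 - r * q by lra.
split.
- rewrite -mulrDr -lnM ?posrE ?divr_gt0 ?invr_gt0//.
  have -> : (1 + r * q) / (1 - r * q) * (a1 / 2^-1 / (a2 / 2^-1)) = H2 / H1.
    have -> : a2 = (1 + r * q) * (H1 * a1) / ((1 - r * q) * H2).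
      by rewrite foc'; field; rewrite !gt_eqF.
    by field; rewrite !gt_eqF.
  rewrite -expRB expRK; field.
  by rewrite s0 !gt_eqF.
- move=> kw.
  have -> : H1 * a1 + H2 * a2 = 2 * (H1 * a1) / (1 - r * q).
    have n0' : 1 - r * q != 0 by rewrite gt_eqF.
    apply: (canRL (mulfK n0')).
    by rewrite mulrDl [H2 * a2 * _]mulrC -foc'; ring.
  by field; rewrite !gt_eqF.
- move=> kw.
  have -> : H1 * a1 + H2 * a2 = 2 * (H2 * a2) / (1 + r * q).
    have p0' : 1 + r * q != 0 by rewrite gt_eqF.
    apply: (canRL (mulfK p0')).
    by rewrite mulrDl [H1 * a1 * _]mulrC foc'; ring.
  by field; rewrite !gt_eqF.
Qed.

End kernel_algebra.

(** * The pricing kernel in equilibrium *)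

Section equilibrium_kernel.
Context {R : realType} {disp : measure_display} {Omega : measurableType disp}.
Variables (P : probability Omega R) (M : market R Omega).
Variables (pihat : strategy R Omega).
Variables (alphahat Yhat Lambdahat : nat -> Omega -> R).
Hypothesis market_hyp : market_axioms P M.
Hypothesis equilibrium_hyp : equilibrium_price P M pihat.
Hypothesis kernel_hyp : pricing_kernel P M alphahat Yhat Lambdahat.
Local Notation N := (nsteps M).
Local Notation F := (filtration M).
Local Notation h := (step M).
Local Notation E := (exp_wealth M pihat).
Local Notation up_return k w :=
  (mu_c M k w * h + sigma_c M k w * Num.sqrt h * 1).
Local Notation down_return k w :=
  (mu_c M k w * h + sigma_c M k w * Num.sqrt h * -1).

Let Fs k (kN : (k <= N)%N) : sigma_algebra [set: Omega] (F k).
Proof. exact: filtration_sigma (market_filtration market_hyp) k kN. Qed.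

Let Fm k (kN : (k <= N)%N) : F k `<=` measurable.
Proof. exact: filtration_sub (market_filtration market_hyp) k kN. Qed.

Let opt : optimal P M pihat. Proof. by case: equilibrium_hyp. Qed.

Let in_asset_hat : adapted_before M N (in_asset pihat).
Proof. exact: in_asset_adapted (optimal_admissible opt). Qed.

Let in_derivative_hat : adapted_before M N (in_derivative pihat).
Proof. exact: in_derivative_adapted (optimal_admissible opt). Qed.

Let E_ge0 w : 0 <= E w. Proof. exact/ltW/exp_wealth_gt0. Qed.

Let iE : rv_integrable P E.
Proof. by apply/exp_wealth_integrable; exact: optimal_integrable opt. Qed.

Let gamma0_gt0 : {ae P, forall w, 0 < gamma0 M w}.
Proof. exact: gamma_gt0 market_hyp _ (leq0n N). Qed.

Let neq1N1 : ((1 == -1 :> R) = false) * ((-1 == 1 :> R) = false).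
Proof. by split; apply/eqP; lra. Qed.

Definition event_marginal (k : nat) (e : R) : Omega -> R :=
  condexp P (F k) (E \* \1_(walk_event M k e)).

Lemma event_marginalP k e : (k < N)%N ->
  is_condexp P (F k) (E \* \1_(walk_event M k e)) (event_marginal k e).
Proof.
move=> kN; apply: (condexpP (Fs (ltnW kN)) (Fm (ltnW kN))).
by apply: integrable_indicM => //; exact: (walk_event_measurable market_hyp).
Qed.

Lemma condexp_exp_wealth_split k : (k < N)%N -> {ae P, forall w,
  condexp P (F k) E w = event_marginal k 1 w + event_marginal k (-1) w}.
Proof.
move=> kN; have kN' := ltnW kN.
have Dw := event_marginalP 1 kN; have Uw := condexpP (Fs kN') (Fm kN') iE.
have mE := rv_integrable_measurable iE.
have dE : is_condexp P (F k) (E \* \1_(walk_event M k (-1)))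
    (condexp P (F k) E \- event_marginal k 1).
  apply: (is_condexp_eq (Fm kN') (is_condexpB (Fs kN') (Fm kN') Uw Dw)).
    apply: measurable_funM => //; apply: measurable_indic.
    exact: (walk_event_measurable market_hyp).
  apply: filterS (walk_event_cover market_hyp kN) => w we /=.
  by rewrite !indic_walk_event; case: we => ->; rewrite eqxx neq1N1 /=; ring.
apply: filterS
  (is_condexp_unique (Fs kN') (Fm kN') (event_marginalP (-1) kN) dE).
by move=> w /= ->; ring.
Qed.

(** The first order condition tests only expectations; applied to perturbations
    supported on an arbitrary B in F_k it gives equality of the integrals over
    B, hence of conditional expectations.  The perturbation is normalized by
    the positive F_k-measurable weight c, which makes it bounded and which is
    divided out at the end. *)
Lemma first_order_condexp k : (k < N)%N -> {ae P, forall w,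
  up_return k w * event_marginal k 1 w +
  down_return k w * event_marginal k (-1) w = 0}.
Proof.
move=> kN; have kN' := ltnW kN; have S := Fs kN'; have Sm := Fm kN'.
pose a w : R := `|gamma0 M w|.
pose b w : R := `|mu_c M k w * h| + `|sigma_c M k w * Num.sqrt h|.
(* Bounds both |th R_k| and |g th R_k| by 1, R_k being the return of C. *)
pose c w : R := expR (- (a w + b w)).
have Fg : rv_wrt (F k) (gamma0 M) by exact: (gamma0_adapted market_hyp).
have Fmu : rv_wrt (F k) (fun w => mu_c M k w * h).
  by apply: (rv_wrtM S);
    [exact: (mu_c_adapted market_hyp)|exact: (rv_wrt_cst S)].
have Fsi : rv_wrt (F k) (fun w => sigma_c M k w * Num.sqrt h).
  by apply: (rv_wrtM S);
    [exact: (sigma_c_adapted market_hyp)|exact: (rv_wrt_cst S)].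
have Fnorm (X : Omega -> R) : rv_wrt (F k) X -> rv_wrt (F k) (fun w => `|X w|).
  exact: (rv_wrt_comp S (@normr_measurable R setT)).
have Fc : rv_wrt (F k) c.
  apply: (rv_wrt_comp S (@measurable_expR R)); apply: (rv_wrtN S).
  apply: (rv_wrtD S); first exact: Fnorm.
  by apply: (rv_wrtD S); exact: Fnorm.
have cb w : 0 <= b w /\ (b w * c w <= 1 /\ a w * (b w * c w) <= 1).
  have b0 : 0 <= b w by apply: addr_ge0.
  by split => //; exact: (mul_expRN_le1 (normr_ge0 _) b0).
have c0 w : 0 < c w by exact: expR_gt0.
have bound w (z : R) : `|z| <= b w ->
    `|c w * z| <= 1 /\ `|gamma0 M w * (c w * z)| <= 1.
  move=> zb; have [b0 [bc1 abc1]] := cb w.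
  have cz : `|c w * z| <= b w * c w.
    by rewrite normrM (gtr0_norm (c0 w)) mulrC ler_wpM2r// ltW.
  split; first exact: le_trans bc1.
  by rewrite normrM; apply: le_trans abc1; rewrite ler_wpM2l// /a normr_ge0.
have upb w : `|up_return k w| <= b w.
  by rewrite mulr1; exact: ler_normD.
have downb w : `|down_return k w| <= b w.
  by rewrite mulrN1; apply: le_trans (ler_normB _ _) _.
have Fup : rv_wrt (F k) (fun w => up_return k w).
  by apply: (rv_wrtD S) => //; apply: (rv_wrtM S) => //; exact: (rv_wrt_cst S).
have Fdown : rv_wrt (F k) (fun w => down_return k w).
  by apply: (rv_wrtD S) => //; apply: (rv_wrtM S) => //; exact: (rv_wrt_cst S).
pose Zu w := gamma0 M w * (c w * up_return k w).
pose Zd w := - (gamma0 M w * (c w * down_return k w)).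
have FZu : rv_wrt (F k) Zu by do 2 apply: (rv_wrtM S) => //.
have FZd : rv_wrt (F k) Zd by apply: (rv_wrtN S); do 2 apply: (rv_wrtM S) => //.
pose Xe e := E \* \1_(walk_event M k e).
have Xe0 e w : 0 <= Xe e w by rewrite /= mulr_ge0.
have [iXe mXe] : (forall e, rv_integrable P (Xe e)) /\
    (forall e, measurable_fun setT (Xe e)).
  have H e : rv_integrable P (Xe e) by case: (event_marginalP e kN).
  by split => // e; exact: rv_integrable_measurable (H e).
have scaled (Z : Omega -> R) e : rv_wrt (F k) Z -> (forall w, `|Z w| <= 1) ->
    is_condexp P (F k) (Z \* Xe e) (Z \* event_marginal k e).
  move=> FZ Z1; apply: (is_condexpM S Sm (Xe0 e) (event_marginalP e kN) FZ).
  apply: (ae_le_integrable _ (iXe e)).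
    by apply: measurable_funM => //; exact: (rv_wrt_measurable Sm).
  by apply: aeW => w; rewrite /= normrM (ger0_norm (Xe0 e w)) ler_piMl.
have Zu1 w : `|Zu w| <= 1 by have [] := bound w _ (upb w).
have Zd1 w : `|Zd w| <= 1 by rewrite normrN; have [] := bound w _ (downb w).
have cu := scaled Zu 1 FZu Zu1; have cd := scaled Zd (-1) FZd Zd1.
have iXu : rv_integrable P (Zu \* Xe 1) by case: cu.
have iXd : rv_integrable P (Zd \* Xe (-1)) by case: cd.
have same B : F k B -> (\int[P]_(w in B) (Zu w * Xe 1 w)%:E =
    \int[P]_(w in B) (Zd w * Xe (-1) w)%:E)%E.
  move=> FB; have mB := Sm _ FB.
  pose th w := c w * \1_B w.
  have Fth : rv_wrt (F k) th.
    by apply: (rv_wrtM S) => //; exact: (rv_wrt_indic S).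
  have thE : {ae P, forall w, th w * return_c M k w =
      c w * (\1_B w * (if incr (b1 M) k w == 1 then up_return k w
                       else down_return k w))}.
    apply: filterS (walk_event_cover market_hyp kN) => w.
    rewrite /return_c /th => -[] ->; rewrite -mulrA ?eqxx//.
    by rewrite neq1N1.
  have th12 : {ae P, forall w, `|th w * return_c M k w| <= 1 /\
      `|gamma0 M w * (th w * return_c M k w)| <= 1}.
    apply: filterS thE => w ->; apply: bound; rewrite normrM indicE.
    have [b0 _] := cb w; case: (_ \in _); last by rewrite normr0 mul0r.
    by rewrite normr1 mul1r; case: ifP.
  have th1 : {ae P, forall w, `|th w * return_c M k w| <= 1}.
    by apply: filterS th12 => w [].
  have th2 : {ae P, forall w, `|gamma0 M w * (th w * return_c M k w)| <= 1}.
    by apply: filterS th12 => w [].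
  have := optimal_first_order market_hyp opt kN Fth th1 th2.
  have iB : rv_integrable P ((Zu \* Xe 1 \- Zd \* Xe (-1)) \* \1_B).
    by apply: integrable_indicM => //; exact: rv_integrableB.
  rewrite (@ae_eq_rv_integral _ _ _ P _
    ((Zu \* Xe 1 \- Zd \* Xe (-1)) \* \1_B))//; first last.
  - apply: filterS2 (walk_event_cover market_hyp kN) thE => w we ->.
    rewrite /Xe /= /Zu /Zd !indic_walk_event.
    by case: we => ->; rewrite eqxx neq1N1 /=; ring.
  - exact: rv_integrable_measurable iB.
  - apply: measurable_funM; last exact: rv_integrable_measurable iE.
    apply: measurable_funM; first exact: rv_wrt_measurable Fg.
    apply: measurable_funM; first exact: rv_wrt_measurable Fth.
    exact: (rv_wrt_measurable (Fm kN) (return_c_adapted market_hyp kN)).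
  rewrite integral_indicM// setTI.
  under eq_integral do rewrite EFinB.
  rewrite integralB_EFin//; [|exact: rv_integrableS..].
  move=> /eqP; rewrite sube_eq ?add0e; first by move=> /eqP.
    by apply: integrable_fin_num => //; exact: rv_integrableS.
  exact: fin_num_adde_defr.
have := is_condexp_eq_integral S Sm cu cd same.
apply: filterS2 gamma0_gt0 => w g0 /=; rewrite /Zu /Zd => H.
have gc : gamma0 M w * c w != 0 by rewrite mulf_neq0// gt_eqF.
apply: (mulfI gc); rewrite mulr0; apply/eqP.
move: H => /eqP; rewrite -subr_eq0 => /eqP H; rewrite -[X in _ == X]H.
by apply/eqP; ring.
Qed.

(** This holds at k as soon as the holdings in C are given by alphahat from time
    k onwards; it is the invariant of the downward induction. *)
Definition tail_factorization (k : nat) : Prop := {ae P, forall w,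
  E w = expR (- gamma0 M w * wealth M pihat k w) * exp_tail M alphahat k w}.

Let gamma0_wealth_adapted k (kN : (k <= N)%N) :
  rv_wrt (F k) (fun w => expR (- gamma0 M w * wealth M pihat k w)).
Proof.
have S := Fs kN; apply: (rv_wrt_comp S (@measurable_expR R)).
apply: (rv_wrtM S); last exact: (wealth_adapted market_hyp).
by apply: (rv_wrtN S); exact: (gamma0_adapted market_hyp).
Qed.

Lemma condexp_exp_wealth_succ k : (k < N)%N -> tail_factorization k.+1 ->
  {ae P, forall w, condexp P (F k.+1) E w =
    expR (- gamma0 M w * (wealth M pihat k.+1 w + Yhat k.+1 w))}.
Proof.
move=> kN fact; have S := Fs kN; have Sm := Fm kN.
have iT := exp_tail_integrable kernel_hyp kN.
have FZ := gamma0_wealth_adapted kN.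
set Z := (fun w => expR _) in FZ.
have mZT : measurable_fun setT (Z \* exp_tail M alphahat k.+1).
  apply: measurable_funM; first exact: (rv_wrt_measurable Sm).
  exact: rv_integrable_measurable iT.
have iZT := ae_eq_integrable mZT iE fact.
have T0 w : 0 <= exp_tail M alphahat k.+1 w by exact: expR_ge0.
have ZT := is_condexpM S Sm T0 (condexpP S Sm iT) FZ iZT.
have EZT : is_condexp P (F k.+1) E
    (Z \* condexp P (F k.+1) (exp_tail M alphahat k.+1)).
  apply: (is_condexp_eq Sm ZT); first exact: rv_integrable_measurable iE.
  by apply: filterS fact => w ->.
have Yeq := Yhat_eq (kernel_eqs kernel_hyp kN).
apply: filterS2 (condexp_ae S Sm EZT) Yeq => w -> Yw.
rewrite -[LHS]/(Z w * condexp P (F k.+1) (exp_tail M alphahat k.+1) w) -Yw.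
by rewrite -expRD; congr expR; ring.
Qed.

(** What X_{k+1} - D_{k+1} amounts to when one unit of the derivative is held,
    apart from the gains made in the asset C; it is known at time k. *)
Definition pre_trade (k : nat) (w : Omega) : R :=
  wealth M pihat k w + dividend_paid M k w - price M k w.

Definition event_discount (k : nat) (e : R) (w : Omega) : R :=
  expR (- gamma0 M w * (pre_trade k w + in_asset pihat k w *
    (mu_c M k w * h + sigma_c M k w * Num.sqrt h * e))).

Lemma event_discount_adapted k e : (k < N)%N ->
  rv_wrt (F k) (event_discount k e).
Proof.
move=> kN; have kN' := ltnW kN; have S := Fs kN'.
apply: (rv_wrt_comp S (@measurable_expR R)); apply: (rv_wrtM S).
  by apply: (rv_wrtN S); exact: (gamma0_adapted market_hyp).
apply: (rv_wrtD S); first apply: (rv_wrtB S).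
- apply: (rv_wrtD S); first exact: (wealth_adapted market_hyp).
  exact: (dividend_paid_adapted market_hyp).
- exact: (price_adapted market_hyp).
- apply: (rv_wrtM S); first exact: in_asset_hat.
  apply: (rv_wrtD S); apply: (rv_wrtM S).
  + exact: (mu_c_adapted market_hyp).
  + exact: (rv_wrt_cst S).
  + apply: (rv_wrtM S); last exact: (rv_wrt_cst S).
    exact: (sigma_c_adapted market_hyp).
  + exact: (rv_wrt_cst S).
Qed.

Lemma condexp_on_event k e : (k < N)%N -> tail_factorization k.+1 ->
  {ae P, forall w, walk_event M k e w ->
    condexp P (F k.+1) E w = event_discount k e w * kernel_weight M Yhat k w}.
Proof.
move=> kN fact; have [_ beta1] := equilibrium_hyp.
apply: filterS2 (condexp_exp_wealth_succ kN fact) (beta1 _ kN) => w -> beta we.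
rewrite /event_discount /kernel_weight -expRD; congr expR.
rewrite /= /wealth_incr beta /return_c.
by have -> : incr (b1 M) k w = e by []; rewrite /pre_trade /incr; ring.
Qed.

(** The discount is known at time k and so comes out of the conditional
    expectation, leaving that of the kernel weight. *)
Lemma event_marginal_kernel k e : (k < N)%N -> tail_factorization k.+1 ->
  {ae P, forall w, event_marginal k e w = event_discount k e w *
    condexp P (F k) (kernel_weight M Yhat k \* \1_(walk_event M k e)) w}.
Proof.
move=> kN fact; have kN' := ltnW kN; have S := Fs kN'; have Sm := Fm kN'.
have FkS : F k `<=` F k.+1 by apply: (filtrationW market_hyp); rewrite leqnSn.
have EV := condexpP (Fs kN) (Fm kN) iE.
have mA := walk_event_measurable market_hyp e kN.
have tower := condexp_tower_indic S (Fs kN) FkS (Fm kN) EV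
  (walk_event_adapted market_hyp e kN).
set V := condexp P (F k.+1) E in EV tower.
have iVA : rv_integrable P (V \* \1_(walk_event M k e)).
  by apply: integrable_indicM => //; case: EV.
have iK := integrable_indicM mA (kernel_weight_integrable kernel_hyp kN).
set K := kernel_weight M Yhat k \* _ in iK *.
have K0 w : 0 <= K w by rewrite /K /= mulr_ge0 ?expR_ge0.
have FH := event_discount_adapted e kN.
have VK : {ae P, forall w, (V \* \1_(walk_event M k e)) w =
    (event_discount k e \* K) w}.
  apply: filterS (condexp_on_event e kN fact) => w Vw.
  rewrite /K /= indic_walk_event; case: eqP => we; last by rewrite !mulr0.
  by rewrite !mulr1; exact: Vw.
have mHK : measurable_fun setT (event_discount k e \* K).
  apply: measurable_funM; first exact: (rv_wrt_measurable Sm).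
  exact: rv_integrable_measurable iK.
have HK := is_condexpM S Sm K0 (condexpP S Sm iK) FH
  (ae_eq_integrable mHK iVA VK).
have VHK : is_condexp P (F k) (V \* \1_(walk_event M k e))
    (event_discount k e \* condexp P (F k) K).
  apply: (is_condexp_eq Sm HK); first exact: rv_integrable_measurable iVA.
  by apply: filterS VK => w ->.
apply: filterS2 tower (condexp_ae S Sm VHK) => w.
by rewrite /event_marginal => -> ->.
Qed.

(** The two conclusions come together from the first order condition: the
    first one feeds the induction, the second is the identity sought. *)
Lemma kernel_step k : (k < N)%N -> tail_factorization k.+1 -> {ae P, forall w,
  in_asset pihat k w = alphahat k w /\
  Lambdahat k.+1 w = condexp P (F k.+1) E w / condexp P (F k) E w}.
Proof.
move=> kN fact; have kN' := ltnW kN.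
have [_ alphaE upE downE] := kernel_eqs kernel_hyp kN.
have e1 : 1 \in [:: 1; -1 : R] by rewrite inE eqxx.
have eN1 : -1 \in [:: 1; -1 : R] by rewrite !inE eqxx orbT.
have E0 : {ae P, forall w, 0 < condexp P (F k) E w}.
  apply: (condexp_gt0 (Fm kN') (exp_wealth_gt0 M pihat)).
  exact: (condexpP (Fs kN') (Fm kN') iE).
have signs := ae_and gamma0_gt0 (ae_and (risk_price_gt0 market_hyp kN)
  (risk_price_small market_hyp kN)).
have marginals := ae_and (event_marginal_kernel 1 kN fact)
  (ae_and (event_marginal_kernel (-1) kN fact)
  (ae_and (first_order_condexp kN)
  (ae_and (condexp_exp_wealth_split kN) E0))).
have events := ae_and (condexp_walk_event market_hyp kN e1)
  (ae_and (condexp_walk_event market_hyp kN eN1)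
  (walk_event_cover market_hyp kN)).
have values := ae_and (condexp_on_event 1 kN fact)
  (condexp_on_event (-1) kN fact).
have kernel := ae_and alphaE (ae_and upE downE).
apply: filterS (ae_and signs (ae_and marginals
  (ae_and events (ae_and values kernel)))) => w
  [[g0 [r0 rq1]] [[m1 [m2 [foc [split_E tot]]]]
  [[pu [pd cover]] [[VU VD] [aE [LU LD]]]]]].
have q0 : 0 < Num.sqrt h by rewrite sqrtr_gt0 (step_gt0 market_hyp).
have hE : h = Num.sqrt h ^+ 2.
  by rewrite sqr_sqrtr// ltW// (step_gt0 market_hyp).
set a1 := condexp _ _ _ w in m1.
set a2 := condexp _ _ _ w in m2.
have disc e : event_discount k e w = expR (- gamma0 M w * (pre_trade k w +
    in_asset pihat k w * (mu_c M k w * Num.sqrt h ^+ 2 +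
    sigma_c M k w * Num.sqrt h * e))) by rewrite -hE.
have foc' : (mu_c M k w * Num.sqrt h ^+ 2 + sigma_c M k w * Num.sqrt h) *
      (event_discount k 1 w * a1) +
    (mu_c M k w * Num.sqrt h ^+ 2 - sigma_c M k w * Num.sqrt h) *
      (event_discount k (-1) w * a2) = 0.
  by rewrite -[RHS]foc m1 m2 -hE; ring.
rewrite split_E m1 m2 in tot.
rewrite !disc in foc' tot.
have [aE' upE' downE'] := kernel_one_step g0 q0 r0 rq1 foc' tot.
have cu : condexp_event P (F k) (kernel_weight M Yhat k) (up_event M k) w
    = a1 / 2^-1.
  by rewrite /condexp_event -[up_event M k]/(walk_event M k 1) pu.
have cd : condexp_event P (F k) (kernel_weight M Yhat k) (down_event M k) w
    = a2 / 2^-1.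
  by rewrite /condexp_event -[down_event M k]/(walk_event M k (-1)) pd.
split; first by rewrite aE cu cd.
rewrite split_E m1 m2 !disc; case: cover => we.
- by rewrite (VU we) (LU we) cu disc; exact: upE'.
- by rewrite (VD we) (LD we) cd disc; exact: downE'.
Qed.

Lemma tail_factorizationP k : (k <= N)%N -> tail_factorization k.
Proof.
move=> kN; rewrite -(subKn kN); elim: (N - k)%N (leq_subr k N) => [|j IH] jN.
  rewrite subn0; apply: aeW => w.
  rewrite /exp_tail big_geq// /exp_wealth /final_wealth -expRD.
  by congr expR; ring.
have jN' : (N - j.+1 < N)%N by rewrite -subSn// subSS leq_subr.
have SE : (N - j.+1).+1 = (N - j)%N by rewrite subnSK.
have fact : tail_factorization (N - j.+1).+1 by rewrite SE; exact/IH/ltnW.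
have [_ beta1] := equilibrium_hyp.
apply: filterS3 fact (kernel_step jN' fact) (beta1 _ jN') =>
  w -> [alphaE _] beta.
rewrite /exp_tail [in RHS]big_ltn// -!expRD; congr expR.
by rewrite /= /wealth_incr beta /Xhat_incr alphaE; ring.
Qed.

Lemma condexp_marginal_utility k : (k <= N)%N ->
  rv_integrable P (final_marginal_utility M pihat) -> {ae P, forall w,
  condexp P (F k) (final_marginal_utility M pihat) w =
  gamma0 M w * condexp P (F k) E w}.
Proof.
move=> kN; have S := Fs kN; have Sm := Fm kN.
have -> : final_marginal_utility M pihat = gamma0 M \* E.
  by apply/funext => w; exact: marginal_utilityE.
move=> iU; apply: (condexp_ae S Sm).
apply: (is_condexpM S Sm E_ge0 (condexpP S Sm iE)) => //.
exact: (gamma0_adapted market_hyp).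
Qed.

End equilibrium_kernel.

Theorem corollary3p3 (R : realType) (disp : measure_display)
    (Omega : measurableType disp) (P : probability Omega R)
    (M : market R Omega) (pihat : strategy R Omega)
    (alphahat Yhat Lambdahat : nat -> Omega -> R)
    (market_hyp : market_axioms P M)
    (equilibrium_hyp : equilibrium_price P M pihat)
    (kernel_hyp : pricing_kernel P M alphahat Yhat Lambdahat)
    (finite_hyp : rv_integrable P (final_marginal_utility M pihat))
    (n : nat) (n_bounds : (1 <= n <= nsteps M)%N) :
  {ae P, forall w,
    Lambdahat (nsteps M - n + 1)%N w =
      condexp P (filtration M (nsteps M - n + 1)%N)
        (final_marginal_utility M pihat) w /
      condexp P (filtration M (nsteps M - n)%N)
        (final_marginal_utility M pihat) w}.
Proof.
case/andP: n_bounds => n1 nN; set k := (nsteps M - n)%N; rewrite addn1.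
have kN : (k < nsteps M)%N by rewrite /k ltn_subrL n1 (leq_trans n1 nN).
have fact := tail_factorizationP market_hyp equilibrium_hyp kernel_hyp kN.
have step := kernel_step market_hyp equilibrium_hyp kernel_hyp kN fact.
have mu1 := condexp_marginal_utility market_hyp equilibrium_hyp kN finite_hyp.
have mu0 := condexp_marginal_utility market_hyp equilibrium_hyp (ltnW kN)
  finite_hyp.
have g0 := gamma_gt0 market_hyp (leq0n _).
apply: filterS (ae_and g0 (ae_and step (ae_and mu1 mu0))).
move=> w [gw [[_ ->] [-> ->]]].
by rewrite -mulf_div divff ?mul1r// gt_eqF.
Qed.
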